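(* Let $p\in\mathbb{N}$, let $\hat y_1,\dots,\hat y_N\in\mathbb{S}^{d-1}$ be distinct incident directions, and for $z\in\mathbb{R}^d$ define the reciprocity gap imaging functional $$I_{RG}(z)=\sum_{j=1}^N\left|\int_{\partial\Omega}u^s(x,\hat y_j)\,\partial_\nu\mathrm{Im}\Phi(x,z)-\partial_\nu u^s(x,\hat y_j)\,\mathrm{Im}\Phi(x,z)\,ds(x)\right|^p.$$ Then $$I_{RG}(z)=\mathcal{O}\Big(\mathrm{dist}(z,D)^{\frac{p(1-d)}{2}}\Big)\qquad\text{as }\mathrm{dist}(z,D)\to\infty,$$ where $\mathrm{dist}(z,D)$ is the distance from $z$ to $D$.
   Context: Setting. Let $d\in\{2,3\}$, $k>0$, and let $D\subset\mathbb{R}^d$ be a bounded, simply connected open set with Lipschitz boundary $\partial D$. Let $\Omega\subset\mathbb{R}^d$ be a bounded, simply connected open set with Lipschitz boundary $\partial\Omega$ and $\overline{D}\subset\Omega$. $\nu$ denotes the unit outward normal (to $D$ on $\partial D$, to $\Omega$ on $\partial\Omega$). $\mathbb{S}^{d-1}=\{x\in\mathbb{R}^d:|x|=1\}$. The matrix-valued function $A\in C^1(\overline{D},\mathbb{C}^{d\times d})$ is symmetric with $\overline{\xi}\cdot\mathrm{Re}(A(x))\xi\ge A_{\min}|\xi|^2$ and $\overline{\xi}\cdot\mathrm{Im}(A(x))\xi\le 0$ for a.e. $x\in D$ and all $\xi\in\mathbb{C}^d$, where $A_{\min}>0$ is constant. The (complex-valued) refractive index $n\in L^\infty(\mathbb{R}^d)$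 satisfies $\mathrm{Im}(n)\ge 0$ a.e. in $D$. Moreover $A=I$ and $n=1$ in $\mathbb{R}^d\setminus\overline{D}$. The real-valued $\eta\in L^\infty(\partial D)$ satisfies $\eta\ge\eta_{\min}>0$ a.e. on $\partial D$. Subscripts $+$ and $-$ denote traces on $\partial D$ from outside and inside $D$. Direct problem. For $\hat y\in\mathbb{S}^{d-1}$ and incident field $u^i(x,\hat y)=e^{\mathrm{i}kx\cdot\hat y}$, the scattered field $u^s=u^s(\cdot,\hat y)\in H^1_{loc}(\mathbb{R}^d\setminus\partial D)$ is the unique solution, with $u=u^s+u^i$, of $\Delta u^s+k^2u^s=0$ in $\mathbb{R}^d\setminus\overline{D}$, $\nabla\cdot A\nabla u+k^2nu=0$ in $D$, $(u^s+u^i)_+=u_-+\mathrm{i}\eta(\nu\cdot A\nabla u_-)$ and $\partial_\nu(u^s+u^i)_+=\nu\cdot A\nabla u_-$ on $\partial D$, together with the radiation condition $\partial_ru^s-\mathrm{i}ku^s=\mathcal{O}(r^{-(d+1)/2})$ as $r=|x|\to\infty$ uniformly in $\hat x=x/r$. Boundary conditions are understood in the usual weak sense. (This problem is well-posed under the standing assumptions, with $\|u^s\|_{H^1(B_R\setminus\partial D)}\le C\|u^i\|_{H^1(D)}$ for any ball $B_R$ centered at the origin with $D\subset B_R$.) $\Phi(x,y)$ is the radiating fundamental solution of the Helmholtz equation: $\Phi(x,y)=\frac{\mathrm{i}}{4}H_0^{(1)}(k|x-y|)$ for $d=2$ and $\Phi(x,y)=\frac{e^{\mathrm{i}k|x-y|}}{4\pi|x-y|}$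 for $d=3$; thus $\mathrm{Im}\Phi(x,z)=\frac14J_0(k|x-z|)$ for $d=2$ and $\frac{k}{4\pi}j_0(k|x-z|)$ for $d=3$ ($J_0$, $j_0$ the Bessel and spherical Bessel functions of the first kind of order $0$). Normal derivatives of $\mathrm{Im}\Phi(x,z)$ are with respect to $x$. *)

(* Defs.v *)
From HB Require Import structures.
From mathcomp Require Import all_boot all_order all_algebra.
From mathcomp Require Import all_classical all_reals all_analysis.
From mathcomp Require Import complex.

Set Implicit Arguments.
Unset Strict Implicit.
Unset Printing Implicit Defensive.
Import Order.TTheory GRing.Theory Num.Theory.
Import numFieldNormedType.Exports.
Local Open Scope classical_set_scope.
Local Open Scope ring_scope.
Local Open Scope complex_scope.

(* The library norm of ['rV[R]_d] is the sup norm: it is used for topology,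
   continuity and derivatives, but every metric quantity below is Euclidean. *)
Definition dotv (R : realType) (d : nat) (x y : 'rV[R]_d) : R :=
  \sum_(i < d) x 0 i * y 0 i.

Definition enorm (R : realType) (d : nat) (x : 'rV[R]_d) : R :=
  Num.sqrt (dotv x x).

Definition eball (R : realType) (d : nat) (c : 'rV[R]_d) (r : R)
  : set 'rV[R]_d := [set x | enorm (x - c) < r].

Definition bvec (R : realType) (d : nat) (i : 'I_d) : 'rV[R]_d := delta_mx 0 i.

Definition bdry (R : realType) (d : nat) (U : set 'rV[R]_d) : set 'rV[R]_d :=
  closure U `\` U°.

Definition dist_set (R : realType) (d : nat) (z : 'rV[R]_d) (U : set 'rV[R]_d) : R :=
  inf [set enorm (z - x) | x in U].

Definition ediam (R : realType) (d : nat) (U : set 'rV[R]_d) : \bar R :=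
  ereal_sup [set e | exists x y, [/\ U x, U y & e = (enorm (x - y))%:E]].

Definition caratheodory_measure (R : realType) (T : pointedType)
    (mu : {outer_measure set T -> \bar R})
    : {measure set (caratheodory_type mu) -> \bar R} :=
  [the measure _ _ of (mu : set (caratheodory_type mu) -> \bar R)].

(* R^d with all its subsets measurable, so that [mu_ext] ranges over arbitrary
   countable covers. *)
Notation cover_space R d := (g_sigma_algebraType [set: set 'rV[R]_d]).

(* Volume of the smallest closed box containing [U]. *)
Definition box_weight (R : realType) (d : nat)
    (U : set 'rV[R]_d) : \bar R :=
  if U == set0 then 0%E else
  ereal_inf [set v | exists a b : 'rV[R]_d,
    [/\ forall i, a 0 i <= b 0 i,
        forall x : 'rV[R]_d, U x -> forall i, a 0 i <= x 0 i <= b 0 i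
      & v = (\prod_(i < d) (b 0 i - a 0 i))%:E]].

Lemma box_weight0 (R : realType) (d : nat) : @box_weight R d set0 = 0%E.
Proof. by rewrite /box_weight eqxx. Qed.

Lemma box_weight_ge0 (R : realType) (d : nat) U : (0 <= @box_weight R d U)%E.
Proof.
rewrite /box_weight; case: ifP => // _.
apply: le_ereal_inf_tmp => _ [a [b [ab _ ->]]].
by rewrite lee_fin prodr_ge0// => i _; rewrite subr_ge0.
Qed.

Definition leb_outer (R : realType) (d : nat) (E : set 'rV[R]_d) : \bar R :=
  mu_ext (@box_weight R d : set (cover_space R d) -> \bar R) E.

HB.instance Definition _ (R : realType) (d : nat) :=
  isOuterMeasure.Build R 'rV[R]_d (@leb_outer R d)
    (@mu_ext0 _ (cover_space R d) _ _ (@box_weight0 R d) (@box_weight_ge0 R d))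
    (@mu_ext_ge0 _ (cover_space R d) _ _ (@box_weight_ge0 R d))
    (@le_mu_ext _ (cover_space R d) _ (@box_weight R d))
    (@mu_ext_sigma_subadditive _ (cover_space R d) _ _ (@box_weight_ge0 R d)).

Definition leb (R : realType) (d : nat) := caratheodory_measure (@leb_outer R d).

(* [omega_s / 2 ^ s], [omega_s] being the volume of the unit ball of R^s, for
   the two cases [s = 1] and [s = 2] of curves and surfaces: it makes the
   s-dimensional Hausdorff measure the length, resp. the area. *)
Definition hausdorff_const (R : realType) (s : nat) : R :=
  if s == 1%N then 1 else pi / 4.

Definition hausdorff_weight (R : realType) (d s : nat) (delta : R)
    (U : set 'rV[R]_d) : \bar R :=
  if U == set0 then 0%E else
  if (ediam U <= delta%:E)%E
  then ((hausdorff_const R s)%:E * ediam U ^+ s)%E else +oo%E.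

Lemma hausdorff_weight0 (R : realType) (d s : nat) (delta : R) :
  @hausdorff_weight R d s delta set0 = 0%E.
Proof. by rewrite /hausdorff_weight eqxx. Qed.

Lemma hausdorff_weight_ge0 (R : realType) (d s : nat) (delta : R) U :
  (0 <= @hausdorff_weight R d s delta U)%E.
Proof.
rewrite /hausdorff_weight; case: ifPn => // /set0P[x Ux]; case: ifP => // _.
apply: mule_ge0.
  by rewrite lee_fin /hausdorff_const; case: ifP => // _; rewrite divr_ge0// pi_ge0.
apply: expe_ge0; apply: ereal_sup_ubound; exists x, x; split => //.
rewrite subrr /enorm /dotv big1 ?sqrtr0// => i _.
by rewrite mxE mul0r.
Qed.

Definition hausdorff_delta (R : realType) (d s : nat) (delta : R)
    (E : set 'rV[R]_d) : \bar R :=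
  mu_ext (@hausdorff_weight R d s delta : set (cover_space R d) -> \bar R) E.

Definition hausdorff (R : realType) (d s : nat) (E : set 'rV[R]_d) : \bar R :=
  ereal_sup [set hausdorff_delta s delta E
            | delta in [set delta : R | 0 < delta]].

Section hausdorff_outer.
Variables (R : realType) (d s : nat).
Local Open Scope ereal_scope.

Let w0 (delta : R) := @hausdorff_weight0 R d s delta.
Let w_ge0 (delta : R) := @hausdorff_weight_ge0 R d s delta.

Let delta_ge0 (delta : R) E : 0 <= @hausdorff_delta R d s delta E :=
  @mu_ext_ge0 _ (cover_space R d) _ _ (w_ge0 delta) E.

Lemma hausdorff_delta_le (delta : R) E : (0 < delta)%R ->
  @hausdorff_delta R d s delta E <= @hausdorff R d s E.
Proof. by move=> delta0; apply: ereal_sup_ubound; exists delta. Qed.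

Lemma hausdorff_ge0 E : 0 <= @hausdorff R d s E.
Proof. exact: le_trans (delta_ge0 _ _) (hausdorff_delta_le E ltr01). Qed.

Lemma hausdorff0 : @hausdorff R d s set0 = 0.
Proof.
apply/eqP; rewrite eq_le hausdorff_ge0 andbT.
apply: ge_ereal_sup => _ [delta _ <-].
by have /eqP := @mu_ext0 _ (cover_space R d) _ _ (w0 delta) (w_ge0 delta);
  rewrite eq_le => /andP[].
Qed.

Lemma le_hausdorff : {homo @hausdorff R d s : A B / A `<=` B >-> A <= B}.
Proof.
move=> A B AB; apply: ge_ereal_sup => _ [delta delta0 <-].
apply: le_trans (hausdorff_delta_le B delta0).
exact: (@le_mu_ext _ (cover_space R d) _ (hausdorff_weight s delta)).
Qed.

Lemma hausdorff_sigma_subadditive : sigma_subadditive (@hausdorff R d s).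
Proof.
move=> F; apply: ge_ereal_sup => _ [delta delta0 <-].
apply: le_trans (@mu_ext_sigma_subadditive _ (cover_space R d) _ _ (w_ge0 delta) F) _.
apply: lee_nneseries => k *; last exact: hausdorff_delta_le.
exact: delta_ge0.
Qed.

HB.instance Definition _ := isOuterMeasure.Build R 'rV[R]_d (@hausdorff R d s)
  hausdorff0 hausdorff_ge0 le_hausdorff hausdorff_sigma_subadditive.

End hausdorff_outer.

(* Surface measure [ds] in R^d: the (d-1)-dimensional Hausdorff measure. *)
Definition surf (R : realType) (d : nat) := caratheodory_measure (@hausdorff R d d.-1).

Definition cint (R : realType) (dsp : measure_display) (T : measurableType dsp)
    (mu : {measure set T -> \bar R}) (S : set T) (f : T -> R[i]) : R[i] :=
  (\int[mu]_(x in S) complex.Re (f x)) +i* (\int[mu]_(x in S) complex.Im (f x)).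

Definition csqr (R : realType) (w : R[i]) : R :=
  complex.Re w ^+ 2 + complex.Im w ^+ 2.

Definition cmeasurable (R : realType) (dsp : measure_display)
    (T : measurableType dsp) (S : set T) (f : T -> R[i]) : Prop :=
  measurable_fun S (fun x => complex.Re (f x)) /\
  measurable_fun S (fun x => complex.Im (f x)).

Definition in_L2 (R : realType) (dsp : measure_display) (T : measurableType dsp)
    (mu : {measure set T -> \bar R}) (S : set T) (f : T -> R[i]) : Prop :=
  cmeasurable S f /\ (\int[mu]_(x in S) (csqr (f x))%:E < +oo)%E.

Definition in_Linfty (R : realType) (dsp : measure_display)
    (T : measurableType dsp) (mu : {measure set T -> \bar R})
    (S : set T) (f : T -> R[i]) : Prop :=
  cmeasurable S f /\
  exists M : R, {ae mu, forall x, S x -> Normc.normc (f x) <= M}.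

Definition L2_cvg (R : realType) (dsp : measure_display) (T : measurableType dsp)
    (mu : {measure set T -> \bar R}) (S : set T)
    (f_ : nat -> T -> R[i]) (f : T -> R[i]) : Prop :=
  (fun m => \int[mu]_(x in S) (csqr (f_ m x - f x))%:E)%E @ \oo --> 0%E.

Definition cderive (R : realType) (d : nat) (f : 'rV[R]_d -> R[i])
    (v x : 'rV[R]_d) : R[i] :=
  ('D_v (fun y => complex.Re (f y)) x) +i* ('D_v (fun y => complex.Im (f y)) x).

Definition cgrad (R : realType) (d : nat) (f : 'rV[R]_d -> R[i])
    (x : 'rV[R]_d) : 'rV[R[i]]_d := \row_i cderive f (bvec R i) x.

Definition claplacian (R : realType) (d : nat) (f : 'rV[R]_d -> R[i])
    (x : 'rV[R]_d) : R[i] :=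
  \sum_(i < d) cderive (cderive f (bvec R i)) (bvec R i) x.

Fixpoint is_Ck (R : realType) (d k : nat) (U : set 'rV[R]_d)
    (f : 'rV[R]_d -> R) : Prop :=
  (forall x, U x -> {for x, continuous f}) /\
  if k is k'.+1 then
    forall i : 'I_d, (forall x, U x -> derivable f x (bvec R i)) /\
                     is_Ck k' U (fun x => 'D_(bvec R i) f x)
  else True.

Definition is_cCk (R : realType) (d k : nat) (U : set 'rV[R]_d)
    (f : 'rV[R]_d -> R[i]) : Prop :=
  is_Ck k U (fun x => complex.Re (f x)) /\ is_Ck k U (fun x => complex.Im (f x)).

(* C^1 up to the boundary of the open set [U]: the first partial derivatives
   extend continuously to the closure. *)
Definition is_C1_closure (R : realType) (d : nat) (U : set 'rV[R]_d)
    (f : 'rV[R]_d -> R) : Prop :=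
  [/\ is_Ck 1 U f, {within closure U, continuous f}
    & forall i : 'I_d, exists g : 'rV[R]_d -> R,
        {within closure U, continuous g} /\
        forall x, U x -> 'D_(bvec R i) f x = g x].

Definition smooth (R : realType) (d : nat) (f : 'rV[R]_d -> R[i]) : Prop :=
  forall k, is_cCk k setT f.

Definition test_function (R : realType) (d : nat) (U : set 'rV[R]_d)
    (f : 'rV[R]_d -> R[i]) : Prop :=
  smooth f /\
  exists K : set 'rV[R]_d, [/\ compact K, K `<=` U & forall x, ~ K x -> f x = 0].

Definition path_connected_set (R : realType) (d : nat) (U : set 'rV[R]_d) : Prop :=
  forall x y, U x -> U y -> exists gamma : R -> 'rV[R]_d,
    [/\ {within `[0, 1], continuous gamma}, gamma 0 = x, gamma 1 = y
      & forall t, `[0, 1]%classic t -> U (gamma t)].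

(* Nonempty, path connected, and every loop in [U] is null-homotopic in [U]. *)
Definition simply_connected (R : realType) (d : nat) (U : set 'rV[R]_d) : Prop :=
  [/\ U !=set0, path_connected_set U
    & forall gamma : R -> 'rV[R]_d, {within `[0, 1], continuous gamma} ->
        (forall t, `[0, 1]%classic t -> U (gamma t)) -> gamma 0 = gamma 1 ->
        exists H : R * R -> 'rV[R]_d,
          [/\ {within `[0, 1] `*` `[0, 1], continuous H},
              forall s t, `[0, 1]%classic s -> `[0, 1]%classic t -> U (H (s, t)),
              forall t, `[0, 1]%classic t -> H (0, t) = gamma t,
              forall t, `[0, 1]%classic t -> H (1, t) = gamma 0
            & forall s, `[0, 1]%classic s ->
                H (s, 0) = gamma 0 /\ H (s, 1) = gamma 0]].

(* Near each boundary point, [U] is the strict subgraph, in some direction [e],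
   of a Lipschitz function of the d-1 coordinates orthogonal to [e]; such a
   function is represented by a function [phi] on R^d invariant along [e]. *)
Definition lipschitz_boundary (R : realType) (d : nat) (U : set 'rV[R]_d) : Prop :=
  forall x0, bdry U x0 ->
    exists (e : 'rV[R]_d) (phi : 'rV[R]_d -> R) (L r : R),
      [/\ enorm e = 1, 0 < r,
          forall x y, `|phi x - phi y| <= L * enorm (x - y),
          forall x t, phi (x + t *: e) = phi x
        & forall x, eball x0 r x -> (U x <-> dotv x e < phi x)].

Definition lipschitz_domain (R : realType) (d : nat) (U : set 'rV[R]_d) : Prop :=
  [/\ open U, bounded_set U, simply_connected U & lipschitz_boundary U].

(* [n] is a unit outward normal to [U] at the boundary point [x]: near [x],
   outside every cone around the hyperplane orthogonal to [n], points on the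
   side of [-n] are in [U] and points on the side of [n] are not. For a
   Lipschitz boundary there is exactly one such [n] at almost every [x], the
   points of differentiability of the local graphs. *)
Definition is_outward_normal (R : realType) (d : nat) (U : set 'rV[R]_d)
    (x n : 'rV[R]_d) : Prop :=
  [/\ bdry U x, enorm n = 1
    & forall eps : R, 0 < eps -> exists2 delta : R, 0 < delta &
        forall y, eball x delta y ->
          (dotv (y - x) n < - (eps * enorm (y - x)) -> U y) /\
          (eps * enorm (y - x) < dotv (y - x) n -> ~ U y)].

Definition outward_normal (R : realType) (d : nat) (U : set 'rV[R]_d)
    (x : 'rV[R]_d) : 'rV[R]_d := xget 0 (is_outward_normal U x).

Definition weak_gradient (R : realType) (d : nat) (U : set 'rV[R]_d)
    (f : 'rV[R]_d -> R[i]) (G : 'rV[R]_d -> 'rV[R[i]]_d) : Prop :=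
  forall (i : 'I_d) (psi : 'rV[R]_d -> R[i]), test_function U psi ->
    cint (@leb R d) U (fun x => f x * cderive psi (bvec R i) x) =
    - cint (@leb R d) U (fun x => G x 0 i * psi x).

(* [f] is in H^1(U), with weak gradient [G]. *)
Definition in_H1 (R : realType) (d : nat) (U : set 'rV[R]_d)
    (f : 'rV[R]_d -> R[i]) (G : 'rV[R]_d -> 'rV[R[i]]_d) : Prop :=
  [/\ in_L2 (@leb R d) U f, forall i : 'I_d, in_L2 (@leb R d) U (fun x => G x 0 i)
    & weak_gradient U f G].

(* [g] is the trace on [Gamma], a part of the boundary of [U], of the function
   [f] of H^1(U) with weak gradient [G]: the limit in L^2(Gamma) of the
   restrictions of smooth functions converging to [f] in H^1(U). *)
Definition is_trace (R : realType) (d : nat) (U Gamma : set 'rV[R]_d)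
    (f : 'rV[R]_d -> R[i]) (G : 'rV[R]_d -> 'rV[R[i]]_d)
    (g : 'rV[R]_d -> R[i]) : Prop :=
  in_L2 (@surf R d) Gamma g /\
  exists phi : nat -> 'rV[R]_d -> R[i],
    [/\ forall m, smooth (phi m),
        L2_cvg (@leb R d) U phi f,
        forall i : 'I_d,
          L2_cvg (@leb R d) U (fun m => cderive (phi m) (bvec R i))
                 (fun x => G x 0 i)
      & L2_cvg (@surf R d) Gamma phi g].

Definition cis (R : realType) (t : R) : R[i] := cos t +i* sin t.

Definition bessel_J0 (R : realType) (t : R) : R :=
  limn (series (fun m : nat =>
    (-1) ^+ m * ((t ^+ 2 / 4) ^+ m / (m`!%:R) ^+ 2))).

Definition harmonic_number (R : realType) (m : nat) : R :=
  \sum_(1 <= j < m.+1) (j%:R)^-1.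

Definition euler_gamma (R : realType) : R :=
  limn (fun m : nat => harmonic_number R m - ln (m%:R)).

Definition bessel_Y0 (R : realType) (t : R) : R :=
  2 / pi * ((ln (t / 2) + euler_gamma R) * bessel_J0 t -
  limn (series (fun m : nat =>
    (-1) ^+ m * harmonic_number R m * ((t ^+ 2 / 4) ^+ m / (m`!%:R) ^+ 2)))).

Definition hankel1_0 (R : realType) (t : R) : R[i] := bessel_J0 t +i* bessel_Y0 t.

(* Meant for [d = 2] and [d = 3] only. On the diagonal x = y, where [Phi] is
   singular, the value is irrelevant. *)
Definition Phi (R : realType) (d : nat) (k : R) (x y : 'rV[R]_d) : R[i] :=
  let r := enorm (x - y) in
  if d == 2%N then 'i%C / 4%:R * hankel1_0 (k * r)
  else cis (k * r) / (4 * pi * r)%:C.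

Definition ImPhi (R : realType) (d : nat) (k : R) (x z : 'rV[R]_d) : R :=
  complex.Im (Phi k x z).

Definition plane_wave (R : realType) (d : nat) (k : R) (yhat x : 'rV[R]_d) : R[i] :=
  cis (k * dotv x yhat).

Definition cdot (R : realType) (d : nat) (v w : 'rV[R[i]]_d) : R[i] :=
  \sum_(i < d) v 0 i * w 0 i.

(* [h] is the conormal derivative [nu . A grad u] on [bdry D], from inside, of
   a weak solution [u] of [div (A grad u) + k^2 n u = 0] in [D], with weak
   gradient [G]. *)
Definition conormal_inside (R : realType) (d : nat) (k : R) (D : set 'rV[R]_d)
    (A : 'rV[R]_d -> 'M[R[i]]_d) (n u : 'rV[R]_d -> R[i])
    (G : 'rV[R]_d -> 'rV[R[i]]_d) (h : 'rV[R]_d -> R[i]) : Prop :=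
  in_L2 (@surf R d) (bdry D) h /\
  forall psi, test_function setT psi ->
    cint (@leb R d) D (fun x => cdot (G x *m (A x)^T) (cgrad psi x)
                                - (k ^+ 2)%:C * n x * u x * psi x) =
    cint (@surf R d) (bdry D) (fun x => h x * psi x).

(* [h] is the derivative, from outside, along the outward normal [nu] of [D]
   of a weak solution of the Helmholtz equation outside [closure D]. *)
Definition conormal_outside (R : realType) (d : nat) (k : R) (D : set 'rV[R]_d)
    (u : 'rV[R]_d -> R[i])
    (G : 'rV[R]_d -> 'rV[R[i]]_d) (h : 'rV[R]_d -> R[i]) : Prop :=
  in_L2 (@surf R d) (bdry D) h /\
  forall psi, test_function setT psi ->
    cint (@leb R d) (~` closure D) (fun x => cdot (G x) (cgrad psi x)
                                             - (k ^+ 2)%:C * u x * psi x) =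
    - cint (@surf R d) (bdry D) (fun x => h x * psi x).

Definition weak_solution_inside (R : realType) (d : nat) (k : R)
    (D : set 'rV[R]_d) (A : 'rV[R]_d -> 'M[R[i]]_d) (n u : 'rV[R]_d -> R[i])
    (G : 'rV[R]_d -> 'rV[R[i]]_d) : Prop :=
  forall psi, test_function D psi ->
    cint (@leb R d) D (fun x => cdot (G x *m (A x)^T) (cgrad psi x)
                                - (k ^+ 2)%:C * n x * u x * psi x) = 0.

Definition radiating (R : realType) (d : nat) (k : R) (us : 'rV[R]_d -> R[i]) : Prop :=
  exists C r0 : R, 0 < r0 /\
    forall (r : R) (xhat : 'rV[R]_d), r0 <= r -> enorm xhat = 1 ->
      Normc.normc (cderive us xhat (r *: xhat) - 'i%C * k%:C * us (r *: xhat))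
        <= C * r `^ (- (d.+1%:R / 2)).

(* [us] is the scattered field of the incident field [ui]. It is identified
   with its representative that is C^2 outside [closure D], where the Helmholtz
   equation and the radiation condition are pointwise. H^1_loc is H^1 on every
   bounded part of R^d minus [bdry D]. Since [eta] is bounded below, the
   transmission conditions make the conormal derivative [h], a priori in
   H^{-1/2}, equal to an L^2 function: (gp - gm) / (i eta). *)
Definition is_scattered_field (R : realType) (d : nat) (k : R) (D : set 'rV[R]_d)
    (A : 'rV[R]_d -> 'M[R[i]]_d) (n : 'rV[R]_d -> R[i]) (eta : 'rV[R]_d -> R)
    (ui us : 'rV[R]_d -> R[i]) : Prop :=
  exists G : 'rV[R]_d -> 'rV[R[i]]_d,
  let u := fun x => us x + ui x in
  let Gu := fun x => G x + cgrad ui x in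
  [/\ forall r : R, 0 < r -> in_H1 (eball 0 r `\` bdry D) us G,
      is_cCk 2 (~` closure D) us /\
      (forall x, ~ closure D x -> claplacian us x + (k ^+ 2)%:C * us x = 0),
      weak_solution_inside k D A n u Gu,
      (exists gp gm hp hm : 'rV[R]_d -> R[i],
        [/\ (forall r : R, closure D `<=` eball 0 r ->
               is_trace (eball 0 r `\` closure D) (bdry D) u Gu gp),
            is_trace D (bdry D) u Gu gm,
            conormal_outside k D u Gu hp,
            conormal_inside k D A n u Gu hm
          & {ae @surf R d, forall x, bdry D x ->
               gp x = gm x + 'i%C * (eta x)%:C * hm x /\ hp x = hm x}])
    & radiating k us].

Definition admissible_A (R : realType) (d : nat) (D : set 'rV[R]_d)
    (A : 'rV[R]_d -> 'M[R[i]]_d) (Amin : R) : Prop :=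
  [/\ (forall i j, is_C1_closure D (fun x => complex.Re (A x i j)) /\
                   is_C1_closure D (fun x => complex.Im (A x i j))),
      (forall x, closure D x -> (A x)^T = A x),
      0 < Amin,
      {ae @leb R d, forall x, D x -> forall xi : 'rV[R[i]]_d,
         (Amin%:C * \sum_(i < d) `|xi 0 i| ^+ 2 <=
          cdot (map_mx conjc xi)
               (xi *m (map_mx (fun w => (complex.Re w)%:C) (A x))^T)) /\
         (cdot (map_mx conjc xi)
               (xi *m (map_mx (fun w => (complex.Im w)%:C) (A x))^T) <= 0)}
    & forall x, ~ closure D x -> A x = 1%:M].

Definition admissible_n (R : realType) (d : nat) (D : set 'rV[R]_d)
    (n : 'rV[R]_d -> R[i]) : Prop :=
  [/\ in_Linfty (@leb R d) setT n,
      {ae @leb R d, forall x, D x -> 0 <= complex.Im (n x)}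
    & {ae @leb R d, forall x, ~ closure D x -> n x = 1}].

Definition admissible_eta (R : realType) (d : nat) (D : set 'rV[R]_d)
    (eta : 'rV[R]_d -> R) (eta_min : R) : Prop :=
  [/\ in_Linfty (@surf R d) (bdry D) (fun x => (eta x)%:C), 0 < eta_min
    & {ae @surf R d, forall x, bdry D x -> eta_min <= eta x}].

Definition I_RG (R : realType) (d : nat) (k : R) (p N : nat)
    (Omega : set 'rV[R]_d) (us : 'I_N -> 'rV[R]_d -> R[i]) (z : 'rV[R]_d) : R :=
  \sum_(j < N) Normc.normc
    (cint (@surf R d) (bdry Omega) (fun x =>
       us j x * ('D_(outward_normal Omega x) (fun y => ImPhi k y z) x)%:C
       - cderive (us j) (outward_normal Omega x) x * (ImPhi k x z)%:C)) ^+ p.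

(* Main.v *)
(* Omega contains the closure of D, so the scattered fields are C^2 near the
   compact set bdry Omega, where they and their first derivatives are bounded;
   being a compact Lipschitz boundary, bdry Omega has finite (d-1)-dimensional
   Hausdorff measure. The reciprocity gap integrals are therefore bounded by a
   constant times the supremum over x in bdry Omega of |Im Phi(x, z)| and of its
   first derivatives. Im Phi(x, z) is a radial function of r = |x - z| which,
   with its derivative, is O(r^((1-d)/2)): this is explicit for d = 3, and for
   d = 2 it follows from an energy estimate for Bessel's equation. Finally |x - z|
   is at least dist(z, D) / 2 once z is far away. *)
Require Import Defs.
From mathcomp Require Import all_boot all_order all_algebra.
From mathcomp Require Import all_classical all_reals all_analysis.
From mathcomp Require Import complex finmap ring lra.
Import Order.TTheory GRing.Theory Num.Theory.
Import numFieldNormedType.Exports.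
Local Open Scope classical_set_scope.
Local Open Scope ring_scope.

(** * Euclidean norm *)

Lemma dotvv_ge0 (R : realType) d (x : 'rV[R]_d) : 0 <= dotv x x.
Proof. by apply: sumr_ge0 => i _; rewrite -expr2 sqr_ge0. Qed.

Lemma enorm_ge0 (R : realType) d (x : 'rV[R]_d) : 0 <= enorm x.
Proof. exact: sqrtr_ge0. Qed.

Lemma enorm_sqr (R : realType) d (x : 'rV[R]_d) : enorm x ^+ 2 = dotv x x.
Proof. by rewrite sqr_sqrtr ?dotvv_ge0. Qed.

Lemma dotvC (R : realType) d (x y : 'rV[R]_d) : dotv x y = dotv y x.
Proof. by apply: eq_bigr => i _; rewrite mulrC. Qed.

Lemma dotvDl (R : realType) d (x y z : 'rV[R]_d) : dotv (x + y) z = dotv x z + dotv y z.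
Proof. by rewrite -big_split; apply: eq_bigr => i _; rewrite mxE mulrDl. Qed.

Lemma dotvZl (R : realType) d a (x z : 'rV[R]_d) : dotv (a *: x) z = a * dotv x z.
Proof. by rewrite /dotv mulr_sumr; apply: eq_bigr => i _; rewrite mxE mulrA. Qed.

Lemma dotvBl (R : realType) d (x y z : 'rV[R]_d) : dotv (x - y) z = dotv x z - dotv y z.
Proof. by rewrite dotvDl -scaleN1r dotvZl mulN1r. Qed.

Lemma dotvv_eq0 (R : realType) d (x y : 'rV[R]_d) : dotv x x = 0 -> dotv x y = 0.
Proof.
move=> /eqP; rewrite psumr_eq0 => [/allP x0|i _]; last by rewrite -expr2 sqr_ge0.
apply: big1 => i _; have := x0 i (mem_index_enum _).
by rewrite /= mulf_eq0 orbb => /eqP ->; rewrite mul0r.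
Qed.

Lemma dotv_le (R : realType) d (x y : 'rV[R]_d) : `|dotv x y| <= enorm x * enorm y.
Proof.
rewrite -ler_sqr ?nnegrE ?normr_ge0 ?mulr_ge0 ?enorm_ge0// exprMn !enorm_sqr.
rewrite real_normK ?num_real//.
have [x0|xN0] := eqVneq (dotv x x) 0; first by rewrite x0 mul0r dotvv_eq0// expr0n.
have xx : 0 < dotv x x by rewrite lt_def xN0 dotvv_ge0.
(* This vector is |x|^2 times the component of [y] orthogonal to [x]; its square is |x|^2 (|x|^2
   |y|^2 - (x.y)^2). *)
have := dotvv_ge0 _ _ (dotv x x *: y - dotv x y *: x).
rewrite dotvBl !dotvZl (dotvC _ _ y) (dotvC _ _ x (_ - _)) !dotvBl !dotvZl (dotvC _ _ y x).
by move=> h; rewrite -subr_ge0 -(pmulr_rge0 _ xx); nra.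
Qed.

Lemma enormD (R : realType) d (x y : 'rV[R]_d) : enorm (x + y) <= enorm x + enorm y.
Proof.
rewrite -ler_sqr ?nnegrE ?addr_ge0 ?enorm_ge0// sqrrD !enorm_sqr.
rewrite dotvDl (dotvC _ _ x) (dotvC _ _ y (_ + _)) !dotvDl (dotvC _ _ y x).
by have := ler_norm (dotv x y); have := dotv_le _ _ x y; lra.
Qed.

Lemma enormZ (R : realType) d a (x : 'rV[R]_d) : enorm (a *: x) = `|a| * enorm x.
Proof. by rewrite /enorm dotvZl dotvC dotvZl mulrA sqrtrM -?expr2 ?sqr_ge0// sqrtr_sqr. Qed.

Lemma enormN (R : realType) d (x : 'rV[R]_d) : enorm (- x) = enorm x.
Proof. by rewrite -scaleN1r enormZ normrN1 mul1r. Qed.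

Lemma enorm0 (R : realType) d : enorm (0 : 'rV[R]_d) = 0.
Proof. by rewrite -(scale0r 0) enormZ normr0 mul0r. Qed.

Lemma enormB (R : realType) d (x y : 'rV[R]_d) : enorm (x - y) = enorm (y - x).
Proof. by rewrite -opprB enormN. Qed.

Lemma ler_dist_enorm (R : realType) d (x y : 'rV[R]_d) :
  `|enorm x - enorm y| <= enorm (x - y).
Proof.
have := enormD _ _ (x - y) y; have := enormD _ _ (y - x) x.
by rewrite !subrK enormB ler_norml; lra.
Qed.

Lemma coord_le_enorm (R : realType) d (x : 'rV[R]_d) i : `|x 0 i| <= enorm x.
Proof.
rewrite -ler_sqr ?nnegrE ?normr_ge0 ?enorm_ge0// enorm_sqr real_normK ?num_real//.
rewrite /dotv (bigD1 i)//= expr2 lerDl; apply: sumr_ge0 => j _.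
by rewrite -expr2 sqr_ge0.
Qed.

Lemma enorm_le_max (R : realType) d (x : 'rV[R]_d) (b : R) :
  0 <= b -> (forall i, `|x 0 i| <= b) -> enorm x <= d%:R * b.
Proof.
move=> b0 xb; rewrite -ler_sqr ?nnegrE ?mulr_ge0 ?enorm_ge0// enorm_sqr.
apply: (@le_trans _ _ (\sum_(i < d) b ^+ 2)).
  apply: ler_sum => i _; rewrite -expr2 -(real_normK (num_real (x 0 i))).
  by rewrite ler_sqr ?nnegrE.
rewrite sumr_const card_ord -[leLHS]mulr_natl exprMn ler_wpM2r ?sqr_ge0//.
by rewrite -natrX ler_nat; case: d {x xb} => // d; rewrite leq_pmulr.
Qed.

Lemma enorm_le_norm (R : realType) d (x : 'rV[R]_d) : enorm x <= d%:R * `|x|.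
Proof.
apply: enorm_le_max => // i.
rewrite [leRHS]/Num.norm/= mx_normrE.
by apply/bigmax_geP; right; exists (0, i).
Qed.

(** * Integrals against an outer measure *)

Section caratheodory_integral.
Context {R : realType} {T : pointedType} (m : {outer_measure set T -> \bar R}).
Local Notation mu := (caratheodory_measure m).
Import HBNNSimple.

Lemma sintegral_le_outer (S : set T) (K : R) (h : {nnsfun caratheodory_type m >-> R}) :
  0 <= K -> (forall x, S x -> h x <= K) -> (forall x, ~ S x -> h x <= 0) ->
  (sintegral mu h <= K%:E * m S)%E.
Proof.
(* The support [B] of [h] is measurable even if [S] is not. It lies in [S], so [h] is below [K]
   times the indicator of [B], and monotonicity of [m] concludes. *)
move=> K0 hS hNS; pose B : set (caratheodory_type m) := [set x | h x != 0].
have mB : measurable B.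
  rewrite (_ : B = ~` (h @^-1` [set 0])); last first.
    by apply/seteqP; split=> x /= /eqP.
  by apply: measurableC.
have BS : B `<=` S.
  move=> x /= /eqP hx; apply: contrapT => /hNS hx0; apply: hx.
  by apply/eqP; rewrite eq_le hx0/=; exact: fun_ge0.
pose g : {nnsfun caratheodory_type m >-> R} := scale_nnsfun (indic_nnsfun R mB) K0.
apply: (@le_trans _ _ (sintegral mu g)).
  apply: le_sintegral => x /=; rewrite /measurable_realfun.mindic indicE.
  have [xB|xB] := pselect (B x); first by rewrite mem_set// mulr1 hS//; exact: BS.
  by rewrite memNset// mulr0; move: xB => /negP; rewrite negbK => /eqP ->.
rewrite sintegralrM sintegral_indic; apply: lee_wpmul2l; first by rewrite lee_fin.
exact: (le_outer_measure m).
Qed.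

(* Neither [S] nor [f] need be measurable: the integral of a nonnegative function
   is the supremum of the integrals of the simple functions below it, and [m] is
   monotone on all sets. *)
Lemma norm_Rintegral_le_outer (S : set T) (f : caratheodory_type m -> R) (K : R) :
  0 <= K -> (forall x, S x -> `|f x| <= K) -> (m S < +oo)%E ->
  `|\int[mu]_(x in S) f x| <= K * fine (m S).
Proof.
move=> K0 fK mS.
have mfin : m S \is a fin_num by rewrite ge0_fin_numE// outer_measure_ge0.
(* The integrals of the positive and negative parts both lie in [0, K m(S)], hence so does the
   absolute value of their difference. *)
have fine_sub_le (a b : \bar R) : (0 <= a -> a <= K%:E * m S -> 0 <= b ->
    b <= K%:E * m S -> `|fine (a - b)|%R%:E <= (K * fine (m S))%R%:E)%E.
  rewrite -{1 2}(fineK mfin) -!EFinM.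
  case: a b => [a| |] [b| |] //; rewrite !lee_fin/= => a0 aK b0 bK.
  by rewrite ler_norml; lra.
suff H (g : caratheodory_type m -> R) : (forall x, S x -> `|g x| <= K) ->
    (0 <= ereal_sup [set sintegral mu h | h in
      [set h : {nnsfun caratheodory_type m >-> R} |
       forall x, (h x)%:E <= ((EFin \o g) \_ S)^\+ x]] <= K%:E * m S)%E.
  rewrite /Rintegral /integral.
  have /andP[p0 pK] := H f fK.
  have /andP[n0 nK] : (0 <= ereal_sup [set sintegral mu h | h in
      [set h : {nnsfun caratheodory_type m >-> R} |
       forall x, (h x)%:E <= ((EFin \o f) \_ S)^\- x]] <= K%:E * m S)%E.
    have <- : (((EFin \o (fun x => - f x)%R) \_ S)^\+ = ((EFin \o f) \_ S)^\-)%E.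
      rewrite -funeposN; congr (_^\+)%E; apply/funext => x; rewrite !patchE.
      by case: ifP => //= _; exact/esym/oppe0.
    by apply: H => x Sx; rewrite normrN; exact: fK.
  exact: fine_sub_le.
move=> gK; apply/andP; split.
  apply: ereal_sup_ubound; exists nnsfun0; last exact: sintegral0.
  by move=> x /=; rewrite funeposE le_max lexx orbT.
apply: ge_ereal_sup => _ [h hg <-]; apply: sintegral_le_outer => // x Sx.
- have := hg x; rewrite funeposE patchE mem_set//= -EFin_max lee_fin => /le_trans; apply.
  by rewrite ge_max K0 andbT; apply: le_trans (gK x Sx); exact: ler_norm.
- by have := hg x; rewrite funeposE patchE memNset//= -EFin_max lee_fin maxxx.
Qed.

End caratheodory_integral.

(** * Hausdorff measure of a Lipschitz boundary *)

Lemma hausdorff_const_ge0 (R : realType) s : 0 <= hausdorff_const R s.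
Proof. by rewrite /hausdorff_const; case: ifP => // _; rewrite divr_ge0 ?pi_ge0. Qed.

Lemma hausdorff_weight_le (R : realType) d s (delta rho : R) (U : set 'rV[R]_d) :
  0 <= rho <= delta -> (forall x y, U x -> U y -> enorm (x - y) <= rho) ->
  (hausdorff_weight s delta U <= (hausdorff_const R s * rho ^+ s)%:E)%E.
Proof.
move=> /andP[rho0 rhod] Urho; rewrite /hausdorff_weight; case: ifPn => [_|/set0P[x0 Ux0]].
  by rewrite lee_fin mulr_ge0 ?exprn_ge0 ?hausdorff_const_ge0.
have dU : (ediam U <= rho%:E)%E.
  by apply: ge_ereal_sup => _ [x [y [Ux Uy ->]]]; rewrite lee_fin; exact: Urho.
have dU0 : (0 <= ediam U)%E.
  by apply: ereal_sup_ubound; exists x0, x0; split => //; rewrite subrr enorm0.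
rewrite (le_trans dU) ?lee_fin// EFinM lee_wpmul2l ?lee_fin ?hausdorff_const_ge0//.
case: (ediam U) dU dU0 => [e| |]//; rewrite !lee_fin => erho e0.
by rewrite -EFin_expe lee_fin lerXn2r.
Qed.

Lemma hausdorff_delta_le_card (R : realType) d s (delta : R) (I : finType)
    (E : set 'rV[R]_d) (F : I -> set 'rV[R]_d) (w : R) :
  E `<=` \bigcup_i F i -> (forall i, (hausdorff_weight s delta (F i) <= w%:E)%E) ->
  (hausdorff_delta s delta E <= (#|I|%:R * w)%:E)%E.
Proof.
(* The default value [set0] of [nth] pads the finite cover to a countable one; the added sets have
   weight 0. *)
move=> EF Fw; pose G k := nth set0 [seq F i | i <- enum I] k.
have szG : size [seq F i | i <- enum I] = #|I| by rewrite size_map -cardE.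
apply: (@le_trans _ _ (\sum_(0 <= k <oo) hausdorff_weight s delta (G k))%E).
  apply: ereal_inf_lbound; exists G => //; split.
    by move=> k; exact: sub_sigma_algebra.
  move=> x /EF[i _ Fix]; exists (index i (enum I)) => //.
  by rewrite /G (nth_map i) ?nth_index ?index_mem// mem_enum.
rewrite (nneseries_split 0 #|I|) => [|k _]; last exact: hausdorff_weight_ge0.
rewrite add0n eseries0 => [|k Ik _]; last first.
  by rewrite /G nth_default ?szG// hausdorff_weight0.
rewrite adde0 big_mkord; apply: (@le_trans _ _ (\sum_(k < #|I|) w%:E)%E).
  apply: lee_sum => k _; rewrite /G (nth_map (enum_val k)) -?cardE//; exact: Fw.
by rewrite sumEFin lee_fin sumr_const card_ord mulr_natl.
Qed.

(* Cutting the cube [-B, B]^s into m^s cubes yields a cover of [E] by m^s sets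
   of diameter at most 2 L B / m. *)
Lemma hausdorff_lt_pinfty (R : realType) d s (E : set 'rV[R]_d)
    (P : 'rV[R]_d -> 'I_s -> R) (B L : R) : 0 < B -> 0 <= L ->
  (forall x j, E x -> `|P x j| < B) ->
  (forall x y b, E x -> E y -> 0 <= b -> (forall j, `|P x j - P y j| <= b) ->
     enorm (x - y) <= L * b) ->
  (hausdorff s E < +oo)%E.
Proof.
move=> B0 L0 PB PL.
apply: (@le_lt_trans _ _ (hausdorff_const R s * (2 * L * B) ^+ s)%:E); last exact: ltry.
apply: ge_ereal_sup => _ [delta delta0 <-].
(* With this [m] the pieces have diameter at most 2LB/m <= delta. *)
pose m := (Num.trunc (2 * L * B / delta)).+1.
have m0 : 0 < m%:R :> R by rewrite ltr0n.
have hm : 2 * L * B / m%:R <= delta.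
  rewrite ler_pdivrMr// [leRHS]mulrC -ler_pdivrMr// ltW//.
  have q0 : 0 <= 2 * L * B / delta by rewrite !mulr_ge0 ?invr_ge0// ltW.
  by have /andP[_] := trunc_itv q0.
pose h := 2 * B / m%:R.
have h0 : 0 < h by rewrite divr_gt0// mulr_gt0.
have hE : L * h = 2 * L * B / m%:R by rewrite /h; ring.
pose F (c : {ffun 'I_s -> 'I_m}) := E `&`
  [set x | forall j, (c j)%:R * h <= P x j + B <= (c j).+1%:R * h].
(* The m^s pieces weigh at most a constant times (2LB/m)^s each: [m] cancels, and the bound is
   uniform in [delta]. *)
have -> : hausdorff_const R s * (2 * L * B) ^+ s =
    #|{ffun 'I_s -> 'I_m}|%:R * (hausdorff_const R s * (L * h) ^+ s).
  rewrite card_ffun !card_ord natrX mulrCA -exprMn hE; congr (_ * _ ^+ _).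
  by rewrite [RHS]mulrC divfK// gt_eqF.
apply: (@hausdorff_delta_le_card _ _ _ _ _ _ F) => [x Ex|c].
- have t0 j : 0 <= (P x j + B) / h.
    by rewrite divr_ge0 ?(ltW h0)//; have := PB x j Ex; rewrite ltr_norml; lra.
  (* The strict bound on [P] puts the quotient below [m], so its truncation is a valid cell
     index. *)
  have tm j : (Num.trunc ((P x j + B) / h) < m)%N.
    rewrite -(ltr_nat R); have /andP[/le_lt_trans + _] := trunc_itv (t0 j); apply.
    rewrite ltr_pdivrMr// /h [ltRHS]mulrC divfK ?gt_eqF//.
    by have := PB x j Ex; rewrite ltr_norml; lra.
  exists [ffun j => Ordinal (tm j)] => //; split=> // j.
  rewrite ffunE /= -(ler_pdivlMr _ _ h0) -(ler_pdivrMr _ _ h0).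
  by have /andP[-> /ltW ->] := trunc_itv (t0 j).
- apply: hausdorff_weight_le; first by rewrite hE hm -hE mulr_ge0// ltW.
  move=> x y [Ex xc] [Ey yc]; apply: PL => // [|j]; first exact: ltW.
  have := xc j; have := yc j; rewrite -!natr1 !mulrDl !mul1r ler_norml.
  by move: (_ * h) => a; lra.
Qed.

Lemma nbhs_eball (R : realType) d (x : 'rV[R]_d) (r : R) : 0 < r -> nbhs x (eball x r).
Proof.
(* A sup-norm ball of this radius lies in the Euclidean ball; [d.+1] keeps the divisor nonzero when
   [d] is 0. *)
move=> r0; apply/nbhs_ballP; exists (r / d.+1%:R); first by rewrite /= divr_gt0.
move=> y; rewrite -ball_normE /= => xy; apply: le_lt_trans (enorm_le_norm _ _ _) _.
rewrite distrC in xy; have := normr_ge0 (y - x).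
move: xy; rewrite ltr_pdivlMr// -natr1 mulrDr mulr1; have := ler0n R d.
by move: `|_| => a; nra.
Qed.

(** A point strictly above the graph has a neighbourhood above it, so it is not in the closure of
    [U]; a point strictly below lies in the open set [U], hence in its interior. *)
Lemma bdry_graph (R : realType) d (U : set 'rV[R]_d) x0 e (phi : 'rV[R]_d -> R) (L r : R) :
  open U -> enorm e = 1 ->
  (forall x y, `|phi x - phi y| <= L * enorm (x - y)) ->
  (forall x, eball x0 r x -> (U x <-> dotv x e < phi x)) ->
  forall x, bdry U x -> eball x0 r x -> dotv x e = phi x.
Proof.
move=> oU e1 phiL Uphi x [cUx NUx] x0x; apply/eqP; rewrite eq_le; apply/andP; split.
  rewrite leNgt; apply/negP => phix.
  have l0 : 0 < `|L| + 1 by rewrite ltr_wpDl.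
  (* Within this radius [dotv y e - phi y], which is (|L|+1)-Lipschitz in [y], stays positive. *)
  have r0 : 0 < (dotv x e - phi x) / (`|L| + 1).
    by rewrite divr_gt0 ?subr_gt0.
  have r1 : 0 < r - enorm (x - x0) by rewrite subr_gt0.
  have [y [Uy [xy xy']]] := cUx _ (filterI (nbhs_eball _ _ x _ r0) (nbhs_eball _ _ x _ r1)).
  move: xy xy'; rewrite /eball/= ltr_pdivlMr// => xy xy'.
  have x0y : eball x0 r y.
    have := enormD _ _ (y - x) (x - x0); rewrite /eball/= addrA subrK.
    by move: xy'; lra.
  have := (Uphi y x0y).1 Uy; have := phiL y x; have := dotv_le _ _ (y - x) e.
  rewrite e1 mulr1 dotvBl !ler_norml.
  have := ler_norm L; have := enorm_ge0 _ _ (y - x); move: xy.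
  move: (enorm _) (dotv _ _) (dotv _ _) `|_| => a b c l; nra.
rewrite leNgt; apply/negP => /(Uphi x x0x).2 Ux; apply: NUx.
by rewrite /interior; exact: open_nbhs_nbhs.
Qed.

Lemma hausdorff_local_graph (R : realType) d (x0 e : 'rV[R]_d.+1)
    (phi : 'rV[R]_d.+1 -> R) (L r : R) : enorm e = 1 ->
  (forall x y, `|phi x - phi y| <= L * enorm (x - y)) ->
  (forall x t, phi (x + t *: e) = phi x) ->
  (hausdorff d [set x | eball x0 r x /\ dotv x e = phi x] < +oo)%E.
Proof.
move=> e1 phiL phie.
have ee : dotv e e = 1 by rewrite -enorm_sqr e1 expr1n.
have [i ei0] : exists i, e 0 i != 0.
  apply: contrapT => /forallNP e0; have := ee; rewrite /dotv big1.
    by move/eqP; rewrite eq_sym oner_eq0.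
  by move=> i _; have /negP := e0 i; rewrite negbK => /eqP ->; rewrite mul0r.
(* [P x] collects the coordinates of the projection of [x] along [e] onto the
   hyperplane [y 0 i = 0]; the graph is Lipschitz over this hyperplane. *)
pose s (x : 'rV[R]_d.+1) := x 0 i / e 0 i.
pose Q (x : 'rV[R]_d.+1) := x - s x *: e.
pose P x (j : 'I_d) := Q x 0 (lift i j).
have Qi x : Q x 0 i = 0 by rewrite !mxE /s divfK// subrr.
have xQ x : x = Q x + s x *: e by rewrite subrK.
have dotQ x : dotv x e = dotv (Q x) e + s x.
  by rewrite {1}(xQ x) dotvDl dotvZl ee mulr1.
have phiQ x : phi x = phi (Q x) by rewrite {1}(xQ x) phie.
have ei : 0 < `|e 0 i| by rewrite normr_gt0.
(* The first constant bounds |x| + |s x|, with 1 added for strictness. In the second, [d.+1] passes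
   from coordinates to the Euclidean norm, and |L| + 2 adds the Lipschitz constants 1 of [Q x] and
   |L| + 1 of [s x]. *)
apply: (@hausdorff_lt_pinfty _ _ _ _ P
  ((enorm x0 + `|r|) * (1 + `|e 0 i|^-1) + 1) ((`|L| + 2) * d.+1%:R)).
- by rewrite ltr_wpDl// mulr_ge0 ?addr_ge0 ?enorm_ge0 ?invr_ge0.
- by rewrite mulr_ge0 ?addr_ge0.
- move=> x j [x0x _]; rewrite -[ltLHS]addr0 ler_ltD//.
  apply: le_trans (coord_le_enorm _ _ (Q x) (lift i j)) _.
  apply: le_trans (enormD _ _ _ _) _; rewrite enormN enormZ e1 mulr1.
  have xr : enorm x <= enorm x0 + `|r|.
    have := enormD _ _ (x - x0) x0; rewrite subrK.
    by move: x0x; rewrite /eball/=; have := ler_norm r; lra.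
  rewrite mulrDr mulr1 lerD// /s normrM normfV ler_pM ?invr_ge0//.
  exact: le_trans (coord_le_enorm _ _ x i) xr.
- move=> x y b [_ xphi] [_ yphi] b0 Pb.
  have Qb : enorm (Q x - Q y) <= d.+1%:R * b.
    apply: enorm_le_max => // j; case: (unliftP i j) => [j' ->|->].
      by have := Pb j'; rewrite /P !mxE.
    by rewrite mxE [in X in _ + X]mxE !Qi subrr normr0.
  (* On the graph, [s x] equals [phi (Q x) - dotv (Q x) e], a Lipschitz function of the
     projection. *)
  have sb : `|s x - s y| <= (`|L| + 1) * enorm (Q x - Q y).
    have -> : s x - s y = (phi (Q x) - phi (Q y)) - dotv (Q x - Q y) e.
      by rewrite -!phiQ -xphi -yphi (dotQ x) (dotQ y) dotvBl; ring.
    apply: le_trans (ler_normB _ _) _; rewrite mulrDl mul1r lerD//.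
      apply: le_trans (phiL _ _) _; rewrite ler_wpM2r ?enorm_ge0//.
      exact: ler_norm.
    by apply: le_trans (dotv_le _ _ _ _) _; rewrite e1 mulr1.
  have -> : x - y = (Q x - Q y) + (s x - s y) *: e.
    by rewrite {1}(xQ x) {1}(xQ y) scalerBl opprD addrACA.
  apply: le_trans (enormD _ _ _ _) _; rewrite enormZ e1 mulr1.
  rewrite -mulrA; apply: (@le_trans _ _ ((`|L| + 2) * enorm (Q x - Q y))).
    by move: sb; lra.
  by rewrite ler_wpM2l// addr_ge0.
Qed.

Lemma bdry_compact (R : realType) d (U : set 'rV[R]_d) :
  bounded_set U -> compact (bdry U).
Proof.
move=> [M [Mr UM]]; apply: bounded_closed_compact.
  exists M; split => // M' MM' x [cUx _].
  have /closure_id -> : closed [set x : 'rV[R]_d | `|x| <= M'].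
    apply: (@closed_comp _ _ (fun x : 'rV[R]_d => `|x|) [set y | y <= M']) => [y _|].
      exact: norm_continuous.
    exact: closed_le.
  by apply: closure_subset cUx => y /UM; exact.
apply: closedI; first exact: closed_closure.
by apply: open_closedC; exact: open_interior.
Qed.

(** By compactness finitely many local graphs cover the boundary; each has finite measure, and
    subadditivity adds them up. *)
Lemma hausdorff_bdry (R : realType) d (U : set 'rV[R]_d.+1) :
  lipschitz_domain U -> (hausdorff d (bdry U) < +oo)%E.
Proof.
move=> [oU bU _ lU].
have loc x0 : exists V : set 'rV[R]_d.+1, bdry U x0 ->
    [/\ open V, V x0 & (hausdorff d (bdry U `&` V) < +oo)%E].
  have [Ux0|NUx0] := pselect (bdry U x0); last by exists set0.
  have [e [phi [L [r [e1 r0 phiL phie Uphi]]]]] := lU _ Ux0.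
  exists (eball x0 r)° => _; split; [exact: open_interior|exact: nbhs_eball|].
  apply: le_lt_trans (hausdorff_local_graph _ _ x0 _ _ L r e1 phiL phie).
  apply: le_hausdorff => x [Ux /interior_subset x0x]; split => //.
  exact: (bdry_graph _ _ _ _ _ _ _ _ oU e1 phiL Uphi).
have [V HV] := choice loc.
have := bdry_compact _ _ U bU; rewrite compact_cover => /(_ _ (bdry U) V).
case => [x /HV[]//|x Ux|D' D'U UV]; first by exists x => //; have [] := HV x Ux.
have {}UV : bdry U `<=` \bigcup_(x in [set` D']) (bdry U `&` V x).
  by move=> x Ux; have [y D'y Vyx] := UV x Ux; exists y.
rewrite bigcup_seq in UV.
apply: le_lt_trans (le_outer_measure (@hausdorff R d.+1 d) _ _ UV) _.
have : forall x, x \in (D' : seq _) -> (hausdorff d (bdry U `&` V x) < +oo)%E.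
  by move=> x /D'U /set_mem /HV[].
elim: (D' : seq _) => [_|x t IH Ht]; first by rewrite big_nil outer_measure0.
rewrite big_cons; apply: le_lt_trans (outer_measureU2 (@hausdorff R d.+1 d) _ _) _.
rewrite lte_add_pinfty ?Ht ?mem_head//; apply: IH => y ty.
by apply: Ht; rewrite inE ty orbT.
Qed.

(** * Bounds on directional derivatives *)

(* Where the difference quotients diverge, ['D_v f x] takes the default value 0,
   so that no differentiability is needed. *)
Lemma norm_derive_le (R : realType) d (f : 'rV[R]_d -> R) (x v : 'rV[R]_d) (K : R) :
  0 <= K -> (\forall h \near 0^', `|f (h *: v + x) - f x| <= K * `|h|) ->
  `|'D_v f x| <= K.
Proof.
move=> K0 fK; rewrite /derive.
have [/cvg_ex[l fl]|/dvgP ->] := pselect (cvg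
  ((fun h : R => h^-1 *: ((f \o shift x) (h *: v) - f x)) @ 0^')); last first.
  by rewrite (_ : point = 0)// normr0.
rewrite (cvg_lim _ fl)//.
apply: (closed_cvg (fun y : R => `|y| <= K) _ _ _ (fl)).
  apply: (@closed_comp _ _ (fun y : R => `|y|) [set y | y <= K]) => [y _|].
    exact: norm_continuous.
  exact: closed_le.
near=> h.
have h0 : h != 0 by near: h; exact: nbhs_dnbhs_neq.
rewrite /= normrM normfV ler_pdivrMl ?normr_gt0// mulrC.
by near: h.
Unshelve. all: by end_near. Qed.

(** Mean value inequality. A hypothesis on the whole ball around [a] treats both orders of [a] and
    [b] at once. *)
Lemma norm_sub_le_deriv (R : realType) (g : R -> R) (a b M : R) :
  (forall t, `|t - a| <= `|b - a| -> derivable g t 1 /\ `|'D_1 g t| <= M) ->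
  `|g b - g a| <= M * `|b - a|.
Proof.
have main c e : c <= e ->
    (forall t, t \in `[c, e] -> derivable g t 1 /\ `|'D_1 g t| <= M) ->
    `|g e - g c| <= M * `|e - c|.
  move=> ce gM.
  have [|| t tce ->] := @MVT_segment _ g (fun t => 'D_1 g t) c e ce.
  - move=> t tce; apply: derivableP; apply: (gM t _).1.
    exact: subset_itv_oo_cc tce.
  - by apply: derivable_within_continuous => t /gM[].
  - by rewrite normrM ler_wpM2r//; exact: (gM t _).2.
move=> gM; case: (leP a b) => ab.
  apply: main => // t; rewrite in_itv/= => /andP[at_ tb]; apply: gM.
  by rewrite !ger0_norm ?subr_ge0// lerD2r.
rewrite distrC (distrC b); apply: main => [|t]; first exact: ltW.
rewrite in_itv/= => /andP[bt ta]; apply: gM.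
by rewrite !ler0_norm ?subr_le0 ?(ltW ab)// lerN2 lerD2r.
Qed.

Lemma derive_line (R : realType) d (f : 'rV[R]_d -> R) (y e : 'rV[R]_d) (t : R) :
  derivable f (t *: e + y) e ->
  derivable (fun t : R => f (t *: e + y)) t 1 /\
  'D_1 (fun t : R => f (t *: e + y)) t = 'D_e f (t *: e + y).
Proof.
have E : (fun h : R => h^-1 *: (((fun t : R => f (t *: e + y)) \o shift t) (h *: 1) -
      f (t *: e + y))) =
    (fun h : R => h^-1 *: ((f \o shift (t *: e + y)) (h *: e) - f (t *: e + y))).
  by apply/funext => h; rewrite /= [h *: 1]mulr1 scalerDl addrA.
by rewrite /derivable /derive E.
Qed.

(** The path from [x] to [w + x] changes one coordinate at a time, through the points [W k + x];
    each leg is a mean value inequality for one partial derivative, and the increments telescope. *)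
Lemma norm_sub_le_partials (R : realType) d (f : 'rV[R]_d -> R) (x w : 'rV[R]_d)
    (r M : R) : `|w| < r ->
  (forall y i, `|y - x| < r ->
     derivable f y (bvec R i) /\ `|'D_(bvec R i) f y| <= M) ->
  `|f (w + x) - f x| <= M * \sum_(i < d) `|w 0 i|.
Proof.
move=> wr fM.
pose W k : 'rV[R]_d := \row_i (if (i < k)%N then w 0 i else 0).
have WS (k : 'I_d) : W k.+1 = w 0 k *: bvec R k + W k.
  apply/rowP => i; rewrite !mxE eqxx/= -val_eqE/= ltnS leq_eqVlt.
  by case: ltngtP => //=; rewrite ?mulr0 ?mulr1 ?add0r ?addr0// => /val_inj ->.
have W0 : W 0 = 0 by apply/rowP => i; rewrite !mxE.
have Wd : W d = w by apply/rowP => i; rewrite !mxE ltn_ord.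
(* Shrinking coordinates does not increase the sup norm, so the path stays in the ball where [fM]
   applies. *)
have lt_norm (u : 'rV[R]_d) : (forall i, `|u 0 i| <= `|w 0 i|) -> `|u| < r.
  move=> uw; apply: le_lt_trans wr; rewrite [leLHS]/Num.norm [leRHS]/Num.norm/= !mx_normrE.
  apply/bigmax_leP; split; first exact: bigmax_ge_id.
  move=> [i j] _ /=; rewrite (ord1 i); apply: le_trans (uw j) _.
  by apply/bigmax_geP; right; exists (0, j).
have -> : f (w + x) - f x = \sum_(0 <= k < d) (f (W k.+1 + x) - f (W k + x)).
  by rewrite telescope_sumr// W0 add0r Wd.
rewrite big_mkord mulr_sumr; apply: le_trans (ler_norm_sum _ _ _) _.
apply: ler_sum => k _; rewrite WS -addrA.
pose g (t : R) := f (t *: bvec R k + (W k + x)).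
have -> : f (W k + x) = g 0 by rewrite /g scale0r add0r.
rewrite -[X in M * `|X|]subr0; apply: (@norm_sub_le_deriv _ g) => t.
rewrite !subr0 => tw.
have [|D1 D2] := fM (t *: bvec R k + (W k + x)) k.
  rewrite addrA addrK; apply: lt_norm => i; rewrite !mxE eqxx/=.
  case: (eqVneq i k) => [->|ik]; first by rewrite mulr1 ltnn addr0.
  by rewrite mulr0 add0r; case: ifP => // _; rewrite normr0.
by have [? ->] := derive_line _ _ _ _ _ _ D1.
Qed.

Lemma continuous_compact_le (R : realType) (T : topologicalType) (K : set T) (f : T -> R) :
  compact K -> (forall x, K x -> {for x, continuous f}) ->
  exists2 C, 0 <= C & forall x, K x -> `|f x| <= C.
Proof.
move=> cK cf.
have : compact (f @` K).
  apply: continuous_compact cK; apply: continuous_in_subspaceT => x /set_mem; exact: cf.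
move=> /compact_bounded[M [_ /(_ (`|M| + 1))]].
rewrite (le_lt_trans (ler_norm M)) ?ltrDl// => /(_ isT) H.
by exists (`|M| + 1) => [|x Kx]; [rewrite addr_ge0|apply: H; exists x].
Qed.

Lemma C1_compact_le (R : realType) d (U K : set 'rV[R]_d) (f : 'rV[R]_d -> R) :
  open U -> compact K -> K `<=` U -> is_Ck 1 U f ->
  exists2 C, 0 <= C & forall x, K x ->
    `|f x| <= C /\ forall v, enorm v <= 1 -> `|'D_v f x| <= C.
Proof.
move=> oU cK KU [cf fU].
have [C0 C00 fC0] := continuous_compact_le _ _ _ _ cK (fun x Kx => cf x (KU x Kx)).
have /choice[C HC] : forall i, exists C, 0 <= C /\ forall x, K x -> `|'D_(bvec R i) f x| <= C.
  move=> i; have [dfi [cfi _]] := fU i.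
  have [C ? ?] := continuous_compact_le _ _ _ _ cK (fun x Kx => cfi x (KU x Kx)).
  by exists C.
(* The added 1 leaves room: by continuity the partial derivatives stay below [M] near each point of
   [K]. *)
pose M := \sum_i C i + 1.
have M0 : 0 <= M by rewrite addr_ge0// sumr_ge0// => i _; exact: (HC i).1.
exists (C0 + M * d%:R); first by rewrite addr_ge0// mulr_ge0.
move=> x Kx; split=> [|v v1]; first by rewrite ler_wpDr ?mulr_ge0 ?fC0.
apply: (@le_trans _ _ (M * d%:R)); last by rewrite lerDr.
have near_le i : \forall y \near x, derivable f y (bvec R i) /\ `|'D_(bvec R i) f y| <= M.
  near=> y; split.
    apply: (fU i).1; near: y; apply: open_nbhs_nbhs; split => //; exact: KU.
  near: y.
  have : {for x, continuous (fun y => `|'D_(bvec R i) f y|)}.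
    apply: continuous_comp; last exact: norm_continuous.
    by apply: (fU i).2.1; exact: KU.
  move/cvgr_le; apply; apply: le_lt_trans ((HC i).2 x Kx) _.
  rewrite /M (bigD1 i)//= -addrA ltrDl ltr_wpDl// sumr_ge0// => j _; exact: (HC j).1.
have := @filter_forall _ _ _ (nbhs x) (nbhs_filter x) near_le.
move=> /nbhs_ballP[r /= r0 xr].
apply: norm_derive_le; first by rewrite mulr_ge0.
near=> h.
have hvr : `|h *: v| < r.
  have v0 : 0 < `|v| + 1 by rewrite ltr_wpDl.
  have : `|h| < r / (`|v| + 1) by near: h; apply: dnbhs0_lt; exact: divr_gt0.
  rewrite normrZ ltr_pdivlMr//; apply: le_lt_trans.
  by rewrite ler_wpM2l// lerDl.
apply: le_trans (norm_sub_le_partials _ _ _ _ _ r M hvr _) _ => [y i yx|].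
  by apply: xr; rewrite -ball_normE/= distrC.
rewrite -mulrA ler_wpM2l//; apply: (@le_trans _ _ (\sum_(i < d) `|h|)).
  apply: ler_sum => i _; rewrite mxE normrM ler_piMr//.
  exact: le_trans (coord_le_enorm _ _ _ _) v1.
by rewrite sumr_const card_ord mulr_natl.
Unshelve. all: by end_near. Qed.

(** * Decay of the Bessel function *)

(* The energy t J'^2 + J J' + J^2 / (2t) + t J^2, which is the energy
   v'^2 + (1 + 1/(4t^2)) v^2 of v = sqrt t * J, has derivative - J^2 / (2t^2). *)
Lemma bessel_ode_decay (R : realType) (J J1 J2 : R -> R) :
  (forall t : R, 0 < t -> is_derive t 1 J (J1 t)) ->
  (forall t : R, 0 < t -> is_derive t 1 J1 (J2 t)) ->
  (forall t, 0 < t -> t * J2 t + J1 t + t * J t = 0) ->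
  exists2 C, 0 <= C & forall t, 1 <= t ->
    `|J t| <= C * t `^ (- 2^-1) /\ `|J1 t| <= C * t `^ (- 2^-1).
Proof.
move=> dJ dJ1 ode.
pose E (t : R) := t * J1 t ^+ 2 + J t * J1 t + J t ^+ 2 * (2 * t)^-1 + t * J t ^+ 2.
pose E' (t : R) := - (J t ^+ 2 * (2 * t ^+ 2)^-1).
have dE (t : R) : 0 < t -> is_derive t 1 E (E' t).
  move=> t0; have dJt := dJ t t0; have dJ1t := dJ1 t t0.
  have d2t : is_derive t 1 (fun t : R => 2 * t) 2.
    by apply: is_derive_eq (is_deriveZ 2 (is_derive_id t 1)) _; rewrite [_ *: _]mulr1.
  have dV : is_derive t 1 (fun t : R => (2 * t)^-1) (- (2 * t) ^- 2 *: 2).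
    by apply: is_deriveV; rewrite mulf_neq0 ?gt_eqF.
  have dS (f : R -> R) df : is_derive t 1 f df -> is_derive t 1 (fun t : R => f t ^+ 2) (2 * f t * df).
    move=> fdf; apply: is_derive_eq (is_deriveX 2 fdf) _.
    by rewrite /= expr1.
  apply: is_derive_eq (is_deriveD (is_deriveD (is_deriveD
    (is_deriveM (is_derive_id t 1) (dS _ _ dJ1t)) (is_deriveM dJt dJ1t))
    (is_deriveM (dS _ _ dJt) dV)) (is_deriveM (is_derive_id t 1) (dS _ _ dJt))) _.
  have J2E : J2 t = - (J1 t + t * J t) / t.
    apply: (mulfI (lt0r_neq0 t0)); rewrite mulrCA divff ?gt_eqF// mulr1.
    by have := ode t t0; lra.
  rewrite J2E /E' /GRing.scale/=; field.
  by rewrite gt_eqF.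
have E1 t : 1 <= t -> E t <= E 1.
  move=> t1; have [|| c ct] := @MVT_segment _ E E' 1 t t1.
  - by move=> x; rewrite in_itv/= => /andP[x1 _]; apply: dE; lra.
  - apply: derivable_within_continuous => x; rewrite in_itv/= => /andP[x1 _].
    by have [] := dE x (lt_le_trans ltr01 x1).
  move=> h; rewrite -subr_le0 h mulNr oppr_le0 mulr_ge0 ?subr_ge0// mulr_ge0 ?sqr_ge0//.
  by rewrite invr_ge0 mulr_ge0 ?sqr_ge0.
(* For [t >= 1], -2 J J1 <= J^2 + J1^2 <= t (J^2 + J1^2), so the cross term costs at most half of
   the leading part of [2 * E t]. *)
have key t : 1 <= t -> t * (J t ^+ 2 + J1 t ^+ 2) <= 2 * E 1.
  move=> t1; have := E1 t t1; rewrite {1}/E.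
  have : 0 <= J t ^+ 2 * (2 * t)^-1 by rewrite mulr_ge0 ?sqr_ge0// invr_ge0; lra.
  by have := sqr_ge0 (J t + J1 t); have := sqr_ge0 (J t); have := sqr_ge0 (J1 t); nra.
have E10 : 0 <= E 1.
  by have := key 1 (lexx _); have := sqr_ge0 (J 1); have := sqr_ge0 (J1 1); lra.
exists (Num.sqrt (2 * E 1)) => [|t t1]; first exact: sqrtr_ge0.
have t0 : 0 < t by lra.
have bound x : t * x ^+ 2 <= 2 * E 1 -> `|x| <= Num.sqrt (2 * E 1) * t `^ (- 2^-1).
  move=> xE; rewrite powRN powR12_sqrt ?(ltW t0)// ler_pdivlMr ?sqrtr_gt0//.
  rewrite -sqrtr_sqr -sqrtrM ?sqr_ge0// ler_wsqrtr// mulrC//.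
by have := key t t1; have := sqr_ge0 (J t); have := sqr_ge0 (J1 t);
  split; apply: bound; nra.
Qed.

(** Comparison with the exponential series at |x|. *)
Lemma is_cvg_pseries_fact (R : realType) (c : R^nat) (x : R) :
  (forall m, `|c m| <= (m`!%:R)^-1) -> cvgn (pseries c x).
Proof.
move=> cm; apply: normed_cvg.
apply: (series_le_cvg _ _ _ (is_cvg_series_exp_coeff `|x|)) => m; rewrite /exp_coeff/=.
- exact: normr_ge0.
- by rewrite divr_ge0.
- by rewrite normrM normrX mulrC ler_wpM2l.
Qed.

(** Since (m+1)/(m+1)! = 1/m!, the bound survives termwise differentiation, so it serves for all
    derivatives. *)
Lemma pseries_diffs_le_fact (R : realType) (c : R^nat) :
  (forall m, `|c m| <= (m`!%:R)^-1) -> forall m, `|pseries_diffs c m| <= (m`!%:R)^-1.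
Proof.
move=> cm m; rewrite /pseries_diffs normrM ger0_norm//.
rewrite -ler_pdivlMl// -invfM -natrM -factS; exact: cm.
Qed.

Lemma is_derive_pseries_fact (R : realType) (c : R^nat) (x : R) :
  (forall m, `|c m| <= (m`!%:R)^-1) ->
  is_derive x 1 (fun x => limn (pseries c x)) (limn (pseries (pseries_diffs c) x)).
Proof.
move=> cm; apply: (@pseries_snd_diffs _ c (`|x| + 1)).
- exact: is_cvg_pseries_fact.
- exact/is_cvg_pseries_fact/pseries_diffs_le_fact.
- exact/is_cvg_pseries_fact/pseries_diffs_le_fact/pseries_diffs_le_fact.
- by rewrite [ltRHS]ger0_norm ?addr_ge0// ltrDl.
Qed.

(** Coefficients of the Bessel function as a power series in s = t^2/4. *)
Definition J0_coeff (R : realType) (m : nat) : R := (-1) ^+ m / (m`!%:R) ^+ 2.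

Lemma J0_coeff_le (R : realType) m : `|J0_coeff R m| <= (m`!%:R)^-1.
Proof.
rewrite normrM normrX normrN1 expr1n mul1r ger0_norm ?invr_ge0 ?sqr_ge0//.
by rewrite lef_pV2 ?posrE ?exprn_gt0 ?ltr0n ?fact_gt0// expr2 ler_peMl// ler1n fact_gt0.
Qed.

(** In the variable s = t^2/4 Bessel's equation reads s G'' + G' + G = 0, which on coefficients is
    (m+1)^2 c_(m+1) = - c_m. *)
Lemma J0_coeff_ode (R : realType) (s : R) :
  let c := J0_coeff R in
  s * limn (pseries (pseries_diffs (pseries_diffs c)) s)
  + limn (pseries (pseries_diffs c) s) + limn (pseries c s) = 0.
Proof.
move=> c; have c0 := J0_coeff_le R; have c1 := pseries_diffs_le_fact _ _ c0.
have c2 := pseries_diffs_le_fact _ _ c1.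
(* The series for G'' is written with unshifted index, so that the three partial sums cancel term by
   term and not only in the limit. *)
have : (s * series (fun m => m%:R * pseries_diffs c m * s ^+ m.-1) n
    + pseries (pseries_diffs c) s n + pseries c s n) @[n --> \oo] -->
  s * limn (pseries (pseries_diffs (pseries_diffs c)) s)
  + limn (pseries (pseries_diffs c) s) + limn (pseries c s).
  apply: cvgD; last exact: is_cvg_pseries_fact.
  apply: cvgD; last exact: is_cvg_pseries_fact.
  apply: cvgM; first exact: cvg_cst.
  exact/pseries_diffs_equiv/is_cvg_pseries_fact.
move=> /(cvg_lim (@Rhausdorff R)) <-; rewrite [X in limn X](_ : _ = cst 0) ?lim_cst//.
apply/funext => n; rewrite /pseries/series/= mulr_sumr -!big_split/=.
(* At [m = 0] the truncated exponent [m.-1] is harmless, the factor [m%:R] being 0. *)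
apply: big1 => m _; have -> : s * (m%:R * pseries_diffs c m * s ^+ m.-1) =
    m%:R * pseries_diffs c m * s ^+ m.
  by case: m => [|m]; rewrite ?mul0r ?mulr0// exprS; ring.
have mf : m`!%:R != 0 :> R by rewrite pnatr_eq0 -lt0n fact_gt0.
rewrite /pseries_diffs /c /J0_coeff factS natrM exprS -natr1; field.
by rewrite mf natr1 pnatr_eq0.
Qed.

Lemma bessel_J0_decay (R : realType) : exists J1 : R -> R,
  (forall t : R, 0 < t -> is_derive t 1 (@bessel_J0 R) (J1 t)) /\
  exists2 C, 0 <= C & forall t, 1 <= t ->
    `|bessel_J0 t| <= C * t `^ (- 2^-1) /\ `|J1 t| <= C * t `^ (- 2^-1).
Proof.
pose c := J0_coeff R; have c0 := J0_coeff_le R; have c1 := pseries_diffs_le_fact _ _ c0.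
pose G i (s : R) := limn (pseries (iter i (@pseries_diffs R) c) s).
have JG t : bessel_J0 t = G 0 (4^-1 * t ^+ 2).
  rewrite /bessel_J0 /G; congr (limn (series _)); apply/funext => m /=.
  by rewrite /c /J0_coeff [4^-1 * _]mulrC; ring.
have dG0 (s : R) : is_derive s 1 (G 0) (G 1 s) by exact: is_derive_pseries_fact.
have dG1 (s : R) : is_derive s 1 (G 1) (G 2 s).
  exact/is_derive_pseries_fact/pseries_diffs_le_fact.
have dh (t : R) : is_derive t 1 (fun t : R => 2^-1 * t) 2^-1.
  by apply: is_derive_eq (is_deriveZ 2^-1 (is_derive_id t 1)) _; rewrite [_ *: _]mulr1.
have dq (t : R) : is_derive t 1 (fun t : R => 4^-1 * t ^+ 2) (2^-1 * t).
  apply: is_derive_eq (is_deriveZ 4^-1 (is_deriveX 2 (is_derive_id t 1))) _.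
  by rewrite /GRing.scale/=; field.
pose J1 (t : R) := G 1 (4^-1 * t ^+ 2) * (2^-1 * t).
have dJ (t : R) : is_derive t 1 (@bessel_J0 R) (J1 t).
  rewrite (_ : @bessel_J0 R = G 0 \o (fun t => 4^-1 * t ^+ 2)); last exact/funext.
  exact: is_derive1_comp.
exists J1; split; first by move=> t _; exact: dJ.
apply: (@bessel_ode_decay R (@bessel_J0 R) J1
  (fun t => G 2 (4^-1 * t ^+ 2) * (2^-1 * t) * (2^-1 * t) + G 1 (4^-1 * t ^+ 2) / 2)).
- move=> t _; apply: is_derive_eq (is_deriveM (is_derive1_comp (dG1 _) (dq t)) (dh t)) _.
  by rewrite /GRing.scale/=; ring.
(* By the chain rule, Bessel's equation at [t] is [t] times the equation for [G] at t^2/4. *)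
- move=> t _; have h : 4^-1 * t ^+ 2 * G 2 (4^-1 * t ^+ 2) + G 1 (4^-1 * t ^+ 2)
      + G 0 (4^-1 * t ^+ 2) = 0 by exact: J0_coeff_ode.
  by rewrite JG /J1 -[RHS](mulr0 t) -h; move: (G 0 _) (G 1 _) (G 2 _) => a b e; field.
Qed.

(** * Decay of the fundamental solution *)

(** The derivative is bounded along with [g] because the functional involves both [ImPhi] and its
    normal derivative. *)
Definition decays (R : realType) (g : R -> R) (a : R) : Prop :=
  exists g1 : R -> R, exists C r0 : R, [/\ 0 <= C, 0 < r0 & forall r : R, r0 <= r ->
    [/\ is_derive r 1 g (g1 r), `|g r| <= C * r `^ a & `|g1 r| <= C * r `^ a]].

Lemma powR_le_half (R : realType) (a s t : R) : a <= 0 -> 0 < t -> t / 2 <= s ->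
  s `^ a <= 2 `^ (- a) * t `^ a.
Proof.
move=> a0 t0 ts; have t2 : 0 < t / 2 by rewrite divr_gt0.
have -> : 2 `^ (- a) * t `^ a = (t / 2) `^ a.
  rewrite powRM ?invr_ge0 ?(ltW t0)// mulrC; congr (_ * _).
  by rewrite -powR_inv1// -powRrM mulN1r.
have s0 : 0 < s by apply: lt_le_trans ts.
rewrite -[a]opprK !(powRN _ (- a)) lef_pV2 ?posrE ?powR_gt0//.
by apply: ge0_ler_powR; rewrite ?oppr_ge0// nnegrE ltW.
Qed.

(** The distance to [z] is 1-Lipschitz, so a step [h *: v] changes the radius by at most |h|, and
    the mean value inequality in the radius bounds the difference quotients. *)
Lemma radial_decay (R : realType) d (g : R -> R) (a : R) : a <= 0 -> decays R g a ->
  exists C M : R, [/\ 0 <= C, 0 < M & forall x z : 'rV[R]_d, M <= enorm (x - z) ->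
    `|g (enorm (x - z))| <= C * enorm (x - z) `^ a /\
    forall v, enorm v <= 1 ->
      `|'D_v (fun y => g (enorm (y - z))) x| <= C * enorm (x - z) `^ a].
Proof.
move=> a0 [g1 [C [r0 [C0 r00 gP]]]].
have p0 : 0 <= 2 `^ (- a) :> R by exact: powR_ge0.
have p1 : 1 <= 2 `^ (- a) :> R by rewrite -[leLHS](powRr0 2) ler_powR ?oppr_ge0// ler1n.
(* For small [h] the radius stays above half of [rho]: hence the threshold [2 * r0] and the factor
   from [powR_le_half]. *)
exists (C * 2 `^ (- a)), (2 * r0); split; [exact: mulr_ge0|lra|].
move=> x z; set rho := enorm (x - z) => rhoM.
have rho0 : 0 < rho by lra.
split=> [|v v1].
  have r0rho : r0 <= rho by lra.
  have [_ grho _] := gP rho r0rho; apply: le_trans grho _.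
  by rewrite ler_wpM2r ?powR_ge0// ler_peMr.
apply: norm_derive_le; first by rewrite !mulr_ge0 ?powR_ge0.
near=> h.
have hrho : `|h| < rho / 2 by near: h; apply: dnbhs0_lt; rewrite divr_gt0.
have drho : `|enorm (h *: v + x - z) - rho| <= `|h|.
  rewrite /rho; apply: le_trans (ler_dist_enorm _ _ _ _) _.
  rewrite opprB addrA subrK addrK enormZ -[leRHS]mulr1.
  by rewrite ler_wpM2l.
apply: (@le_trans _ _ (C * 2 `^ (- a) * rho `^ a * `|enorm (h *: v + x - z) - rho|)).
  apply: norm_sub_le_deriv => t /le_trans/(_ drho) trho.
  have rt : rho / 2 <= t.
    by move: (le_lt_trans trho hrho); rewrite ltr_norml; lra.
  have r0t : r0 <= t by lra.
  have [dg _ g1t] := gP t r0t.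
  rewrite derive_val; split; first exact: ex_derive.
  apply: le_trans g1t _; rewrite -mulrA ler_wpM2l//; exact: powR_le_half.
by rewrite ler_wpM2l// !mulr_ge0// powR_ge0.
Unshelve. all: by end_near. Qed.

Lemma ImPhi2E (R : realType) (k : R) (x z : 'rV[R]_2) :
  ImPhi k x z = 4^-1 * bessel_J0 (k * enorm (x - z)).
Proof.
rewrite /ImPhi /Phi /= (_ : 1 + (1 + (1 + 1)) = 4); last by ring.
by rewrite !addr0; field.
Qed.

Lemma ImPhi3E (R : realType) (k : R) (x z : 'rV[R]_3) :
  ImPhi k x z = sin (k * enorm (x - z)) * (4 * pi * enorm (x - z))^-1.
Proof. by rewrite /ImPhi /Phi -fmorphV/= mulr0 add0r. Qed.

Lemma decays_J0 (R : realType) (k : R) : 0 < k ->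
  decays R (fun r => 4^-1 * bessel_J0 (k * r)) (- 2^-1).
Proof.
move=> k0; have [J1 [dJ [C C0 JC]]] := bessel_J0_decay R.
pose c := k `^ (- 2^-1).
have c0 : 0 <= c by exact: powR_ge0.
(* The threshold makes [k * r >= 1]; [c] comes from scaling the power, and [1 + k] covers both the
   value and the chain rule factor [k]. *)
exists (fun r => 4^-1 * (J1 (k * r) * k)), (C * c * (1 + k)), k^-1; split.
- by rewrite !mulr_ge0// addr_ge0// ltW.
- by rewrite invr_gt0.
move=> r kr; have r0 : 0 < r by apply: lt_le_trans kr; rewrite invr_gt0.
have kr1 : 1 <= k * r by rewrite -ler_pdivrMl// mulr1.
have dk : is_derive r 1 (fun r : R => k * r) k.
  by apply: is_derive_eq (is_deriveZ k (is_derive_id r 1)) _; rewrite [_ *: _]mulr1.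
have powE : (k * r) `^ (- 2^-1) = c * r `^ (- 2^-1) by rewrite powRM ?(ltW k0) ?(ltW r0).
have [J0le J1le] := JC _ kr1; rewrite powE mulrA in J0le J1le.
have w0 : 0 <= C * c * r `^ (- 2^-1) by rewrite !mulr_ge0// powR_ge0.
rewrite -[_ * (1 + k) * _]mulrAC; split.
- have dJk : is_derive (k * r) 1 (@bessel_J0 R) (J1 (k * r)).
    by apply: dJ; rewrite mulr_gt0.
  exact: is_deriveZ (is_derive1_comp dJk dk).
- rewrite normrM ger0_norm ?invr_ge0//; move: J0le w0.
  by move: `|_| (C * c * _) (normr_ge0 (bessel_J0 (k * r))) => A B A0 AB B0; nra.
- rewrite !normrM ger0_norm ?invr_ge0// (gtr0_norm k0); move: J1le w0.
  by move: `|_| (C * c * _) (normr_ge0 (J1 (k * r))) => A B A0 AB B0; nra.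
Qed.

Lemma decays_sinc (R : realType) (k : R) : 0 < k ->
  decays R (fun r => sin (k * r) * (4 * pi * r)^-1) (- 1).
Proof.
move=> k0; move: (@pi R) (pi_gt0 R) => P P0; pose C : R := (4 * P)^-1.
have pi0 : 0 < 4 * P by rewrite mulr_gt0.
have C0 : 0 < C by rewrite invr_gt0.
(* For [r >= 1] the term in r^-2 is dominated by r^-1, which gives the constant [1 + k]. *)
exists (fun r => C * (k * cos (k * r) * r^-1 - sin (k * r) * r ^- 2)), (C * (1 + k)), 1; split.
- by rewrite mulr_ge0 ?addr_ge0 ?(ltW k0) ?(ltW C0).
- exact: ltr01.
move=> r r1; have r0 : 0 < r by lra.
have rV : r^-1 <= 1 by rewrite invf_le1.
have rV0 : 0 < r^-1 by rewrite invr_gt0.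
rewrite powR_inv1 ?(ltW r0)//.
have s1 : `|sin (k * r)| <= 1 by rewrite ler_norml sin_geN1 sin_le1.
have c1 : `|cos (k * r)| <= 1 by rewrite ler_norml cos_geN1 cos_le1.
split.
- have dk : is_derive r 1 (fun r : R => k * r) k.
    by apply: is_derive_eq (is_deriveZ k (is_derive_id r 1)) _; rewrite [_ *: _]mulr1.
  have dp : is_derive r 1 (fun r : R => 4 * P * r) (4 * P).
    by apply: is_derive_eq (is_deriveZ (4 * P) (is_derive_id r 1)) _; rewrite [_ *: _]mulr1.
  have nz : 4 * P * r != 0 by rewrite gt_eqF// mulr_gt0.
  have dV : is_derive r 1 (fun r : R => (4 * P * r)^-1) (- (4 * P * r) ^- 2 *: (4 * P)).
    exact: is_deriveV.
  apply: is_derive_eq (is_deriveM (is_derive1_comp (is_derive_sin (k * r)) dk) dV) _.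
  rewrite /GRing.scale/= /C; field.
  by rewrite !gt_eqF.
- have CV : 0 < C * r^-1 by rewrite mulr_gt0.
  rewrite normrM invfM -/C (gtr0_norm CV) [leRHS]mulrAC mulrC.
  apply: ler_wpM2l; first exact: ltW.
  by apply: le_trans s1 _; rewrite lerDl ltW.
- rewrite normrM (gtr0_norm C0) -[leRHS]mulrA; apply: ler_wpM2l; first exact: ltW.
  rewrite mulrDl mul1r.
  apply: le_trans (ler_normB _ _) _; rewrite [leRHS]addrC !normrM (gtr0_norm k0) (gtr0_norm rV0).
  rewrite normfV (ger0_norm (sqr_ge0 r)) -exprVn expr2; apply: lerD.
    by rewrite ler_wpM2r ?(ltW rV0)// ler_piMr// ltW.
  have rr : r^-1 * r^-1 <= r^-1 by rewrite ler_piMr// ltW.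
  by move: (normr_ge0 (sin (k * r))) s1 rr rV0; move: `|_| => A; nra.
Qed.

Lemma ImPhi_decay (R : realType) d (k : R) : d = 2%N \/ d = 3%N -> 0 < k ->
  exists C M : R, [/\ 0 <= C, 0 < M & forall x z : 'rV[R]_d, M <= enorm (x - z) ->
    `|ImPhi k x z| <= C * enorm (x - z) `^ ((1 - d%:R) / 2) /\
    forall v, enorm v <= 1 ->
      `|'D_v (fun y => ImPhi k y z) x| <= C * enorm (x - z) `^ ((1 - d%:R) / 2)].
Proof.
move=> [->|->] k0.
  rewrite (_ : (1 - 2%:R) / 2 = - 2^-1); last by field.
  have := radial_decay R 2 _ _ (_ : - 2^-1 <= 0) (decays_J0 R k k0).
  case; first by rewrite oppr_le0 invr_ge0.
  move=> C [M [C0 M0 H]]; exists C, M; split=> // x z xz.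
  have [H1 H2] := H x z xz; rewrite ImPhi2E; split=> // v v1.
  rewrite (_ : (fun y => _) = fun y => 4^-1 * bessel_J0 (k * enorm (y - z))); last first.
    by apply/funext => y; rewrite ImPhi2E.
  exact: H2.
rewrite (_ : (1 - 3%:R) / 2 = - 1); last by field.
have := radial_decay R 3 _ _ (_ : - 1 <= 0) (decays_sinc R k k0).
case; first by rewrite oppr_le0.
move=> C [M [C0 M0 H]]; exists C, M; split=> // x z xz.
have [H1 H2] := H x z xz; rewrite ImPhi3E; split=> // v v1.
rewrite (_ : (fun y => _) = fun y => sin (k * enorm (y - z)) * (4 * pi * enorm (y - z))^-1).
  exact: H2.
by apply/funext => y; rewrite ImPhi3E.
Qed.

(** * The imaging functional *)

Lemma dist_set_le (R : realType) d (U : set 'rV[R]_d) (z y : 'rV[R]_d) :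
  U y -> dist_set z U <= enorm (z - y).
Proof.
move=> Uy; apply: ge_inf; last by exists y.
by exists 0 => _ [x _ <-]; exact: enorm_ge0.
Qed.

(** An inequality only: where no outward normal exists, [xget] returns the default 0. *)
Lemma enorm_outward_normal (R : realType) d (U : set 'rV[R]_d) x :
  enorm (outward_normal U x) <= 1.
Proof.
rewrite /outward_normal; case: xgetP => [n _ [_ -> _]//|_].
by rewrite enorm0.
Qed.

Lemma normc_le (R : realType) (w : R[i]) :
  Normc.normc w <= `|complex.Re w| + `|complex.Im w|.
Proof.
case: w => a b /=; rewrite -[leRHS]ger0_norm ?addr_ge0// -sqrtr_sqr ler_wsqrtr//.
rewrite sqrrD !real_normK ?num_real//.
by have := mulr_ge0 (normr_ge0 a) (normr_ge0 b); lra.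
Qed.

(** The decay of [ImPhi] is a hypothesis with free exponent [a], so one argument serves both
    dimensions; with dimension [d.+1] the surface measure comes from [hausdorff d]. *)
Lemma I_RG_decay (R : realType) (d : nat) (k a : R) (D Omega : set 'rV[R]_d.+1)
    (p N : nat) (us : 'I_N -> 'rV[R]_d.+1 -> R[i]) :
  a <= 0 -> D !=set0 -> lipschitz_domain Omega -> closure D `<=` Omega ->
  (forall j, is_cCk 2 (~` closure D) (us j)) ->
  (exists C M : R, [/\ 0 <= C, 0 < M & forall x z : 'rV[R]_d.+1, M <= enorm (x - z) ->
    `|ImPhi k x z| <= C * enorm (x - z) `^ a /\
    forall v, enorm v <= 1 ->
      `|'D_v (fun y => ImPhi k y z) x| <= C * enorm (x - z) `^ a]) ->
  exists C M : R, forall z, M <= dist_set z D ->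
    I_RG k p Omega us z <= C * (dist_set z D `^ a) ^+ p.
Proof.
move=> a0 [x1 Dx1] lOmega DOmega us2 [CP [M [CP0 M0 PhiP]]].
have [oOmega bOmega _ _] := lOmega.
have cK := bdry_compact _ _ _ bOmega.
have oU : open (~` closure D) by apply: closed_openC; exact: closed_closure.
have KU : bdry Omega `<=` ~` closure D.
  by move=> x [_ Nx] /DOmega Ox; apply: Nx; exact: open_nbhs_nbhs.
have /choice[Cu HCu] : forall j, exists C, 0 <= C /\ forall x, bdry Omega x ->
    [/\ `|complex.Re (us j x)| <= C, `|complex.Im (us j x)| <= C
      & forall v, enorm v <= 1 -> `|complex.Re (cderive (us j) v x)| <= C /\
                                  `|complex.Im (cderive (us j) v x)| <= C].
  move=> j; have [[cRe dRe] [cIm dIm]] := us2 j.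
  have C1Re : is_Ck 1 (~` closure D) (fun x => complex.Re (us j x)).
    by split=> // i; have [? [? _]] := dRe i.
  have C1Im : is_Ck 1 (~` closure D) (fun x => complex.Im (us j x)).
    by split=> // i; have [? [? _]] := dIm i.
  have [C C0 HC] := C1_compact_le _ _ _ _ _ oU cK KU C1Re.
  have [C' C'0 HC'] := C1_compact_le _ _ _ _ _ oU cK KU C1Im.
  exists (C + C'); split=> [|x Kx]; first exact: addr_ge0.
  have [H1 H2] := HC x Kx; have [H1' H2'] := HC' x Kx.
  split=> [||v v1]; [by rewrite ler_wpDr|by rewrite ler_wpDl|].
  by split; [rewrite ler_wpDr// H2|rewrite ler_wpDl// H2'].
have [B B0 HB] : exists2 B, 0 <= B & forall x, bdry Omega x -> enorm (x - x1) <= B.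
  have [B B0 HB] := continuous_compact_le _ _ _ (fun x : 'rV[R]_d.+1 => `|x|) cK
    (fun x _ => @norm_continuous _ _ x).
  exists (d.+1%:R * B + enorm x1) => [|x Kx]; first by rewrite addr_ge0 ?mulr_ge0 ?enorm_ge0.
  rewrite -(enormN _ _ x1); apply: le_trans (enormD _ _ _ _) _; rewrite lerD2r.
  apply: le_trans (enorm_le_norm _ _ _) _; rewrite ler_wpM2l//.
  by have := HB x Kx; rewrite normr_id.
pose H := fine (hausdorff d (bdry Omega)).
have H0 : 0 <= H by apply: fine_ge0; exact: hausdorff_ge0.
pose P := CP * 2 `^ (- a).
have P0 : 0 <= P by rewrite mulr_ge0 ?powR_ge0.
(* The factor 4 counts two products in the integrand, for the real and the imaginary part. For x on
   the boundary |x - z| >= delta - B, which beyond this threshold is at least [M] and at least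
   [delta / 2]. *)
exists (\sum_(j < N) (4 * Cu j * P * H) ^+ p), (2 * (B + M)) => z zD.
set delta := dist_set z D in zD *.
have delta0 : 0 < delta by lra.
have w0 : 0 <= P * delta `^ a by rewrite mulr_ge0 ?powR_ge0.
have far x : bdry Omega x -> M <= enorm (x - z) /\ delta / 2 <= enorm (x - z).
  move=> Kx; have := dist_set_le _ _ _ z _ Dx1; rewrite -/delta.
  have := enormD _ _ (z - x) (x - x1); rewrite addrA subrK (enormB _ _ z x).
  by have := HB x Kx; lra.
have PhiK x : bdry Omega x -> `|ImPhi k x z| <= P * delta `^ a /\ forall v, enorm v <= 1 ->
    `|'D_v (fun y => ImPhi k y z) x| <= P * delta `^ a.
  move=> Kx; have [Mx dx] := far x Kx; have [P1 P2] := PhiP x z Mx.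
  have le : CP * enorm (x - z) `^ a <= P * delta `^ a.
    by rewrite -mulrA ler_wpM2l// powR_le_half.
  by split=> [|v v1]; [exact: le_trans le|exact: le_trans (P2 v v1) le].
rewrite mulr_suml; apply: ler_sum => j _; rewrite -exprMn.
have [Cj0 Cj] := HCu j.
apply: lerXn2r; rewrite ?nnegrE.
- by rewrite /Normc.normc; case: cint => ? ?; exact: sqrtr_ge0.
- by rewrite !mulr_ge0 ?powR_ge0.
apply: le_trans (normc_le _ _) _; rewrite /cint/=.
have -> : 4 * Cu j * P * H * delta `^ a =
    2 * Cu j * (P * delta `^ a) * H + 2 * Cu j * (P * delta `^ a) * H by ring.
have prod2 s t u v (b c : R) : 0 <= b -> 0 <= c -> `|s| <= b -> `|t| <= c ->
    `|u| <= b -> `|v| <= c -> `|s * t - u * v| <= 2 * b * c.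
  move=> b0 c0 sb tc ub vc; apply: le_trans (ler_normB _ _) _; rewrite !normrM.
  by rewrite -mulrA mulr2n mulrDl mul1r lerD// ler_pM.
have hfin := hausdorff_bdry _ _ _ lOmega.
have K0 : 0 <= 2 * Cu j * (P * delta `^ a) by rewrite mulr_ge0// mulr_ge0.
apply: lerD; apply: (@norm_Rintegral_le_outer R _ (@hausdorff R d.+1 d) _ _ _ K0 _ hfin) =>
  x Kx; have n1 := enorm_outward_normal _ _ Omega x;
  have [P1 /(_ _ n1) P2] := PhiK x Kx; have [u1 u2 /(_ _ n1)[u3 u4]] := Cj x Kx.
- have -> : forall (w1 w2 : R[i]) (t v : R),
      complex.Re (w1 * t%:C%C - w2 * v%:C%C) = complex.Re w1 * t - complex.Re w2 * v.
    by move=> [? ?] [? ?] ? ? /=; rewrite !mulr0 !subr0.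
  exact: prod2.
- have -> : forall (w1 w2 : R[i]) (t v : R),
      complex.Im (w1 * t%:C%C - w2 * v%:C%C) = complex.Im w1 * t - complex.Im w2 * v.
    by move=> [? ?] [? ?] ? ? /=; rewrite !mulr0 !add0r.
  exact: prod2.
Qed.

Theorem theorem4p2 (R : realType) (d : nat) (hd : d = 2%N \/ d = 3%N)
    (k : R) (hk : 0 < k)
    (D Omega : set 'rV[R]_d)
    (hD : lipschitz_domain D) (hOmega : lipschitz_domain Omega)
    (hDOmega : closure D `<=` Omega)
    (A : 'rV[R]_d -> 'M[R[i]]_d) (Amin : R) (hA : admissible_A D A Amin)
    (n : 'rV[R]_d -> R[i]) (hn : admissible_n D n)
    (eta : 'rV[R]_d -> R) (eta_min : R) (heta : admissible_eta D eta eta_min)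
    (p N : nat) (yhat : 'I_N -> 'rV[R]_d)
    (hyhat : forall j, enorm (yhat j) = 1) (hdistinct : injective yhat)
    (us : 'I_N -> 'rV[R]_d -> R[i])
    (hus : forall j, is_scattered_field k D A n eta (plane_wave k (yhat j)) (us j)) :
  exists C M : R, forall z : 'rV[R]_d, M <= dist_set z D ->
    I_RG k p Omega us z <= C * dist_set z D `^ (p%:R * (1 - d%:R) / 2).
Proof.
have Phid := ImPhi_decay _ _ _ hd hk.
have a0 : (1 - d%:R) / 2 <= 0 :> R.
  by case: hd => ->; rewrite pmulr_lle0 ?invr_gt0// subr_le0 ler1n.
have us2 j : is_cCk 2 (~` closure D) (us j) by have [G [_ [? _] _ _ _]] := hus j.
have D0 : D !=set0 by have [_ _ []] := hD.
have -> : p%:R * (1 - d%:R) / 2 = (1 - d%:R) / 2 * p%:R :> R by ring.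
(* Both dimensions are successors, the form in which [I_RG_decay] is stated. *)
have [e de] : exists e, d = e.+1 by case: hd => ->; eexists.
clear hd hA hn heta hyhat hdistinct hus A n eta yhat hD; subst d.
have [C [M H]] := I_RG_decay _ _ _ _ _ _ p _ _ a0 D0 hOmega hDOmega us2 Phid.
by exists C, M => z zD; rewrite powRrM powR_mulrn ?powR_ge0//; exact: H.
Qed.
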